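(* Let $0<R\le\infty$, let $\rho$ be a radial conformal metric on the disk $\{w\in\mathbf{C}:|w|<R\}$, and let $r>0$ satisfy $$r<\int_0^R\rho(s)\,ds.$$ Let $f:\mathbf{U}\to D_\rho(0,r)$ be a real (i.e. real-valued) $\rho$-harmonic function with $f(0)=0$. Then for all $z,z_1,z_2\in\mathbf{U}$, $$\int_0^{|f(z)|}\rho(s)\,ds\le \frac{4r}{\pi}\arctan|z|,$$ $$\rho(|f(z)|)\,|\nabla f(z)|\le \frac{4r}{\pi}\,\frac{1}{1-|z|^2},$$ $$d_\rho(f(z_1),f(z_2))\le \frac{4r}{\pi}\,d_h(z_1,z_2).$$
   Context: $\mathbf{U}=\{z\in\mathbf{C}:|z|<1\}$ is the unit disk. A conformal metric on a domain $D\subset\mathbf{C}$ is a positive function $\rho\in C^1(D)$; it is radial if $\rho(w)=\rho(|w|)$ depends only on $|w|$. The $\rho$-length of a curve $\Gamma\subset D$ is $\int_\Gamma\rho(w)\,|dw|$, and $d_\rho(w_1,w_2)$ is the infimum of $\rho$-lengths of curves in $D$ joining $w_1$ and $w_2$. The geodesic disk is $D_\rho(\omega,r)=\{w\in D:d_\rho(w,\omega)<r\}$; here $D=\{|w|<R\}$. A $C^2$ mapping $f:\mathbf{U}\to D$ is called $\rho$-harmonic if $$f_{z\bar z}+\big((\partial_w\log\rho^2)\circ f\big)\, f_z f_{\bar z}=0\quad\text{in }\mathbf{U},$$ where $f_z,f_{\bar z}$ are the Wirtinger derivatives. The hyperbolic distance on $\mathbf{U}$ is $d_h(z,w)=\tanh^{-1}\left|\frac{z-w}{1-\bar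 z w}\right|$. *)

(* Defs.v *)
From Stdlib Require Import Reals.
From Coquelicot Require Import Coquelicot.
Open Scope R_scope.

Definition disk (Rad : Rbar) (w : C) : Prop := Rbar_lt (Finite (Cmod w)) Rad.

Definition unit_disk : C -> Prop := disk (Finite 1).

Definition pdx (g : C -> R) (z : C) : R :=
  Derive (fun x : R => g (x, Im z)) (Re z).
Definition pdy (g : C -> R) (z : C) : R :=
  Derive (fun y : R => g (Re z, y)) (Im z).

(* The set [D] is meant to be open: the continuity of the partial derivatives
   is required on full neighbourhoods of the points of [D]. *)
Definition C1_on (D : C -> Prop) (g : C -> R) : Prop :=
  forall z : C, D z ->
    ex_derive (fun x : R => g (x, Im z)) (Re z) /\
    ex_derive (fun y : R => g (Re z, y)) (Im z) /\
    continuous (pdx g) z /\ continuous (pdy g) z.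

Definition C2_on (D : C -> Prop) (g : C -> R) : Prop :=
  C1_on D g /\ C1_on D (pdx g) /\ C1_on D (pdy g).

Definition norm_grad (g : C -> R) (z : C) : R :=
  sqrt (pdx g z ^ 2 + pdy g z ^ 2).

Definition Cpdx (F : C -> C) (z : C) : C :=
  (pdx (fun w => Re (F w)) z, pdx (fun w => Im (F w)) z).
Definition Cpdy (F : C -> C) (z : C) : C :=
  (pdy (fun w => Re (F w)) z, pdy (fun w => Im (F w)) z).

Definition dz (F : C -> C) (z : C) : C :=
  ((Cpdx F z - Ci * Cpdy F z) / RtoC 2)%C.
Definition dzbar (F : C -> C) (z : C) : C :=
  ((Cpdx F z + Ci * Cpdy F z) / RtoC 2)%C.

Definition conformal_metric (D : C -> Prop) (rho : C -> R) : Prop :=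
  C1_on D rho /\ forall w : C, D w -> 0 < rho w.

Definition radial (D : C -> Prop) (rho : C -> R) : Prop :=
  forall w : C, D w -> rho w = rho (RtoC (Cmod w)).

(* [total] is the possibly infinite integral of [g] over 0 <= s < Rad, as the
   limit of the integrals from 0 to [t] when [t] tends to [Rad] from below. *)
Definition is_integral_upto (g : R -> R) (Rad total : Rbar) : Prop :=
  filterlim (fun t : R => RInt g 0 t)
    (within (fun t : R => Rbar_lt (Finite t) Rad) (Rbar_locally Rad))
    (Rbar_locally total).

Definition C1_line (h : R -> R) : Prop :=
  forall t : R, ex_derive h t /\ continuous (Derive h) t.

(* Only the restriction of [gamma] to the unit interval matters. On each closed piece of
   a subdivision it has to coincide with a C^1 map defined on the whole line,
   i.e. it is C^1 up to the end points of the piece. *)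
Definition piecewise_C1 (gamma : R -> C) : Prop :=
  exists (n : nat) (t : nat -> R),
    t 0%nat = 0 /\ t n = 1 /\
    forall i : nat, (i < n)%nat ->
      t i < t (S i) /\
      exists g : R -> C,
        C1_line (fun s => Re (g s)) /\ C1_line (fun s => Im (g s)) /\
        forall s : R, t i <= s <= t (S i) -> gamma s = g s.

(* At the subdivision points of a piecewise C^1 curve the value may be
   meaningless; it does not affect the integral below. *)
Definition speed (gamma : R -> C) (t : R) : R :=
  Cmod (Derive (fun s => Re (gamma s)) t, Derive (fun s => Im (gamma s)) t).

Definition rho_length (rho : C -> R) (gamma : R -> C) : R :=
  RInt (fun t => rho (gamma t) * speed gamma t) 0 1.

Definition curve_joining (D : C -> Prop) (w1 w2 : C) (gamma : R -> C) : Prop :=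
  piecewise_C1 gamma /\ (forall t : R, 0 <= t <= 1 -> D (gamma t)) /\
  gamma 0 = w1 /\ gamma 1 = w2.

Definition d_rho (D : C -> Prop) (rho : C -> R) (w1 w2 : C) : Rbar :=
  Glb_Rbar (fun l : R =>
    exists gamma : R -> C,
      curve_joining D w1 w2 gamma /\ l = rho_length rho gamma).

Definition geodesic_disk (D : C -> Prop) (rho : C -> R) (omega : C) (r : R)
    (w : C) : Prop :=
  D w /\ Rbar_lt (d_rho D rho w omega) (Finite r).

Definition artanh (x : R) : R := / 2 * ln ((1 + x) / (1 - x)).

Definition d_hyp (z w : C) : R :=
  artanh (Cmod ((z - w) / (RtoC 1 - Cconj z * w))%C).

Definition rho_harmonic (D : C -> Prop) (rho : C -> R) (f : C -> C) : Prop :=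
  C2_on unit_disk (fun z => Re (f z)) /\
  C2_on unit_disk (fun z => Im (f z)) /\
  (forall z : C, unit_disk z -> D (f z)) /\
  forall z : C, unit_disk z ->
    (dzbar (dz f) z
     + dz (fun w => RtoC (ln (rho w ^ 2))) (f z) * dz f z * dzbar f z)%C
    = RtoC 0.

(* Main.v *)
(* Since rho is radial, G(x) = int_0^x rho is odd and, for real f, the equation of
   rho-harmonicity says exactly that F = G o f is harmonic; a curve from f(z) to 0 has rho-length
   at least |G(f(z))|, so E = F/r maps the disk into (-1,1).  The gradient of E is encoded by the
   holomorphic function q = E_x - i E_y, and the mean value property of q, zq and z^2 q gives
     int E(s e^{it}) dt = 2 pi E(0)  and  int E(s e^{it}) cos t dt = pi s Re q(0).
   The bathtub principle then yields |grad E(0)| <= (4/pi) cos(pi E(0)/2), and composing with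
   disk automorphisms gives |grad E(z)| <= (4/pi) cos(pi E(z)/2) / (1-|z|^2) everywhere.
   Integrating this differential inequality along radii gives both the arctangent bound and the
   Lipschitz bound. *)

(* The inequality with the cosine is the Schwarz-Pick lemma for holomorphic maps into the strip |Re
   w| < 1, read on the real part E: with density 1/(1-|z|^2) on the disk, the strip has hyperbolic
   density (pi/4)/cos(pi Re w/2), and (4/pi) Re arctan z is extremal. It is derived here from E and
   its gradient alone. The 4 is the integral of |cos| over a full period, which is the first moment
   of the extremal step function when E(0) = 0; the 1/pi comes from the moment formula. Keeping the
   cosine is what separates the two final bounds. Replacing it by 1 leaves the density 1/(1-|z|^2),
   whose integral along a radius is artanh |z|; dividing by it before integrating gives the stronger
   arctangent bound, which requires E(0) = 0. Since f may change sign, the signed primitive G is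
   used in place of the integral up to |f|: G o f stays smooth at the zeros of f, and absolute
   values are taken only at the end. *)
Require Import Defs.
From Stdlib Require Import Reals Lra Lia.
From Coquelicot Require Import Coquelicot.
Open Scope R_scope.

(** * Gradients of functions of two real variables *)

(** Full real differentiability rather than existence of partial derivatives: the chain rule along
    curves and through maps of the disk fails for mere partials. The module [C_R_NormedModule] makes
    the differential real-linear. *)
Definition is_grad (g : C -> R) (z : C) (a b : R) : Prop :=
  @filterdiff R_AbsRing C_R_NormedModule R_NormedModule g (locally z)
    (fun u => Re u * a + Im u * b).

Lemma is_grad_ext_loc (g h : C -> R) (z : C) (a b : R) :
  locally z (fun w => g w = h w) -> is_grad g z a b -> is_grad h z a b.
Proof.
  intros He Hg.
  apply (filterdiff_ext_locally (K := R_AbsRing) (U := C_R_NormedModule)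
           (V := R_NormedModule) g h); [exact He | exact Hg].
Qed.

Lemma is_grad_const (c : R) (z : C) : is_grad (fun _ => c) z 0 0.
Proof.
  eapply filterdiff_ext_lin;
    [apply (filterdiff_const (K := R_AbsRing) (U := C_R_NormedModule) (V := R_NormedModule))|].
  intros y; simpl; unfold zero; simpl; ring.
Qed.

Lemma is_grad_Re (z : C) : is_grad Re z 1 0.
Proof.
  eapply filterdiff_ext_lin.
  - apply (filterdiff_linear (K := R_AbsRing) (U := C_R_NormedModule)
             (V := R_NormedModule) (F := locally z) (fun u => fst u)).
    apply is_linear_fst.
  - intros y; unfold Re; simpl; ring.
Qed.

Lemma is_grad_Im (z : C) : is_grad Im z 0 1.
Proof.
  eapply filterdiff_ext_lin.
  - apply (filterdiff_linear (K := R_AbsRing) (U := C_R_NormedModule)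
             (V := R_NormedModule) (F := locally z) (fun u => snd u)).
    apply is_linear_snd.
  - intros y; unfold Im; simpl; ring.
Qed.

Lemma is_grad_plus (g h : C -> R) (z : C) (a b c d : R) :
  is_grad g z a b -> is_grad h z c d ->
  is_grad (fun w => g w + h w) z (a + c) (b + d).
Proof.
  intros Hg Hh. eapply filterdiff_ext_lin.
  - exact (filterdiff_plus_fct (K := R_AbsRing) (V := R_NormedModule) _ _ _ _ Hg Hh).
  - intros y; simpl; unfold plus; simpl; ring.
Qed.

Lemma is_grad_minus (g h : C -> R) (z : C) (a b c d : R) :
  is_grad g z a b -> is_grad h z c d ->
  is_grad (fun w => g w - h w) z (a - c) (b - d).
Proof.
  intros Hg Hh. eapply filterdiff_ext_lin.
  - exact (filterdiff_minus_fct (K := R_AbsRing) (V := R_NormedModule) _ _ _ _ Hg Hh).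
  - intros y; simpl; unfold minus, plus, opp; simpl; ring.
Qed.

Lemma is_grad_mult (g h : C -> R) (z : C) (a b c d : R) :
  is_grad g z a b -> is_grad h z c d ->
  is_grad (fun w => g w * h w) z (a * h z + g z * c) (b * h z + g z * d).
Proof.
  intros Hg Hh. eapply filterdiff_ext_lin.
  - exact (filterdiff_mult_fct (K := R_AbsRing) g h z _ _ Rmult_comm Hg Hh).
  - intros y; simpl; unfold plus, mult; simpl; ring.
Qed.

Lemma is_grad_comp_derive (h : R -> R) (g : C -> R) (z : C) (l a b : R) :
  is_derive h (g z) l -> is_grad g z a b ->
  is_grad (fun w => h (g w)) z (l * a) (l * b).
Proof.
  intros Hh Hg. eapply filterdiff_ext_lin.
  - exact (filterdiff_comp' (K := R_AbsRing) (U := C_R_NormedModule)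
            (V := R_NormedModule) (W := R_NormedModule) g h z _ _ Hg Hh).
  - intros y; simpl; unfold scal; simpl; unfold mult; simpl; ring.
Qed.

Lemma is_grad_comp (g u v : C -> R) (z : C) (a b c d e f : R) :
  is_grad g (u z, v z) a b -> is_grad u z c d -> is_grad v z e f ->
  is_grad (fun w => g (u w, v w)) z (a * c + b * e) (a * d + b * f).
Proof.
  intros Hg Hu Hv.
  assert (Hp : @filterdiff R_AbsRing C_R_NormedModule C_R_NormedModule
    (fun w => (u w, v w)) (locally z)
    (fun y => (Re y * c + Im y * d, Re y * e + Im y * f))).
  { apply (filterdiff_comp_2 (K := R_AbsRing) (T := C_R_NormedModule)
      (FF := @filter_filter _ _ (@locally_filter C_UniformSpace z))
      (U := R_NormedModule) (V := R_NormedModule) (W := C_R_NormedModule)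
      u v (fun x y => (x, y)) _ _ (fun x y => (x, y)) Hu Hv).
    apply filterdiff_linear. apply is_linear_prod; [apply is_linear_fst | apply is_linear_snd]. }
  eapply filterdiff_ext_lin.
  - exact (filterdiff_comp' (K := R_AbsRing) (U := C_R_NormedModule)
            (V := C_R_NormedModule) (W := R_NormedModule) _ g z _ _ Hp Hg).
  - intros y; simpl; ring.
Qed.

Lemma is_grad_curve (g : C -> R) (x y : R -> R) (t a b c d : R) :
  is_grad g (x t, y t) a b -> is_derive x t c -> is_derive y t d ->
  is_derive (fun s => g (x s, y s)) t (a * c + b * d).
Proof.
  intros Hg Hx Hy.
  assert (Hp : @filterdiff R_AbsRing R_NormedModule C_R_NormedModule
    (fun w => (x w, y w)) (locally t) (fun s => (scal s c, scal s d))).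
  { apply (filterdiff_comp_2 (K := R_AbsRing) (T := R_NormedModule)
      (FF := @filter_filter _ _ (@locally_filter R_UniformSpace t))
      (U := R_NormedModule) (V := R_NormedModule) (W := C_R_NormedModule)
      x y (fun x y => (x, y)) _ _ (fun x y => (x, y)) Hx Hy).
    apply filterdiff_linear. apply is_linear_prod; [apply is_linear_fst | apply is_linear_snd]. }
  unfold is_derive. eapply filterdiff_ext_lin.
  - exact (filterdiff_comp' (K := R_AbsRing) (U := R_NormedModule)
            (V := C_R_NormedModule) (W := R_NormedModule) _ g t _ _ Hp Hg).
  - intros s; simpl. unfold scal; simpl; unfold mult; simpl; ring.
Qed.

Lemma is_grad_pdx (g : C -> R) (z : C) (a b : R) :
  is_grad g z a b -> is_derive (fun x => g (x, Im z)) (Re z) a.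
Proof.
  intros Hg. destruct z as [x y].
  replace a with (a * 1 + b * 0) by ring.
  apply (is_grad_curve g (fun x => x) (fun _ => y)); auto.
  - apply (is_derive_id (K := R_AbsRing)).
  - apply (is_derive_const (K := R_AbsRing) (V := R_NormedModule)).
Qed.

Lemma is_grad_continuous (g : C -> R) (z : C) (a b : R) :
  is_grad g z a b -> continuous g z.
Proof.
  intros Hg.
  apply (filterdiff_continuous (K := R_AbsRing) (U := C_R_NormedModule)
    (V := R_NormedModule)).
  eexists; exact Hg.
Qed.

(** The gradient is carried as explicit functions, so that gradients of sums, products and
    composites are formulas that can be compared with the Cauchy-Riemann equations. *)
Definition C1_grad (D : C -> Prop) (g gx gy : C -> R) : Prop :=
  forall z : C, D z ->
    is_grad g z (gx z) (gy z) /\ continuous gx z /\ continuous gy z.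

(** Continuous partial derivatives give differentiability. Openness of [D] supplies the x-derivative
    on a whole neighbourhood of the point. *)
Lemma C1_grad_of_C1_on (D : C -> Prop) (g : C -> R) :
  (forall z, D z -> locally z D) -> C1_on D g -> C1_grad D g (pdx g) (pdy g).
Proof.
  intros HD Hg z Dz.
  destruct (Hg z Dz) as (Hx & Hy & Cx & Cy).
  split; [|split; assumption].
  unfold is_grad.
  destruct z as [x y].
  eapply filterdiff_ext_lin.
  - eapply filterdiff_ext; [|apply (is_derive_filterdiff (fun x y => g (x, y)) x y
      (fun x y => pdx g (x, y)) (pdy g (x, y)))].
    + intros [? ?]; reflexivity.
    + apply filter_imp with (2 := HD _ Dz).
      intros [u v] Du. apply Derive_correct. apply (Hg _ Du).
    + apply Derive_correct. exact Hy.
    + apply continuous_ext with (2 := Cx). intros [? ?]; reflexivity.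
  - intros [u v]; simpl. unfold plus, scal; simpl; unfold mult; simpl; ring.
Qed.

(** Brings the raw output of the calculus rules into the shape demanded by [holo] and [harm]. The
    identities are checked on [D] only, which matters where a denominator vanishes elsewhere. *)
Lemma C1_grad_ext (D : C -> Prop) (g gx gy h hx hy : C -> R) :
  (forall z, D z -> locally z D) -> C1_grad D g gx gy ->
  (forall z, D z -> g z = h z) -> (forall z, D z -> gx z = hx z) ->
  (forall z, D z -> gy z = hy z) -> C1_grad D h hx hy.
Proof.
  intros HD Hg Eg Ex Ey z Dz. destruct (Hg z Dz) as (H1 & H2 & H3).
  split; [|split].
  - rewrite <- Ex, <- Ey; auto. apply is_grad_ext_loc with (2 := H1).
    apply filter_imp with (2 := HD _ Dz); auto.
  - apply continuous_ext_loc with (2 := H2).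
    apply filter_imp with (2 := HD _ Dz); auto.
  - apply continuous_ext_loc with (2 := H3).
    apply filter_imp with (2 := HD _ Dz); auto.
Qed.

Lemma C1_grad_continuous (D : C -> Prop) (g gx gy : C -> R) (z : C) :
  C1_grad D g gx gy -> D z -> continuous g z.
Proof. intros Hg Dz; eapply is_grad_continuous; apply (Hg z Dz). Qed.

Lemma continuous_Rplus {U : UniformSpace} (f g : U -> R) (x : U) :
  continuous f x -> continuous g x -> continuous (fun y => f y + g y) x.
Proof. apply (continuous_plus (V := R_NormedModule)). Qed.

Lemma continuous_Rminus {U : UniformSpace} (f g : U -> R) (x : U) :
  continuous f x -> continuous g x -> continuous (fun y => f y - g y) x.
Proof. apply (continuous_minus (V := R_NormedModule)). Qed.

Lemma continuous_Rmult {U : UniformSpace} (f g : U -> R) (x : U) :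
  continuous f x -> continuous g x -> continuous (fun y => f y * g y) x.
Proof. apply (continuous_mult (K := R_AbsRing)). Qed.

Lemma C1_grad_plus (D : C -> Prop) (g gx gy h hx hy : C -> R) :
  C1_grad D g gx gy -> C1_grad D h hx hy ->
  C1_grad D (fun w => g w + h w) (fun w => gx w + hx w) (fun w => gy w + hy w).
Proof.
  intros Hg Hh z Dz.
  destruct (Hg z Dz) as (? & ? & ?), (Hh z Dz) as (? & ? & ?).
  auto using is_grad_plus, @continuous_Rplus.
Qed.

Lemma C1_grad_minus (D : C -> Prop) (g gx gy h hx hy : C -> R) :
  C1_grad D g gx gy -> C1_grad D h hx hy ->
  C1_grad D (fun w => g w - h w) (fun w => gx w - hx w) (fun w => gy w - hy w).
Proof.
  intros Hg Hh z Dz.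
  destruct (Hg z Dz) as (? & ? & ?), (Hh z Dz) as (? & ? & ?).
  auto using is_grad_minus, @continuous_Rminus.
Qed.

Lemma C1_grad_mult (D : C -> Prop) (g gx gy h hx hy : C -> R) :
  C1_grad D g gx gy -> C1_grad D h hx hy ->
  C1_grad D (fun w => g w * h w)
    (fun w => gx w * h w + g w * hx w) (fun w => gy w * h w + g w * hy w).
Proof.
  intros Hg Hh z Dz.
  pose proof (C1_grad_continuous _ _ _ _ _ Hg Dz).
  pose proof (C1_grad_continuous _ _ _ _ _ Hh Dz).
  destruct (Hg z Dz) as (? & ? & ?), (Hh z Dz) as (? & ? & ?).
  auto using is_grad_mult, @continuous_Rplus, @continuous_Rmult.
Qed.

Lemma continuous_pair_C {U : UniformSpace} (u v : U -> R) (x : U) :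
  continuous u x -> continuous v x ->
  @continuous U C_UniformSpace (fun y => (u y, v y)) x.
Proof.
  intros Hu Hv. apply (continuous_comp_2 u v (fun a b => (a, b))); auto.
  apply continuous_ext with (fun t => t); [intros [? ?]; reflexivity|].
  apply continuous_id.
Qed.

Lemma C1_grad_comp (D D' : C -> Prop) (g gx gy u ux uy v vx vy : C -> R) :
  C1_grad D g gx gy -> C1_grad D' u ux uy -> C1_grad D' v vx vy ->
  (forall z, D' z -> D (u z, v z)) ->
  C1_grad D' (fun w => g (u w, v w))
    (fun w => gx (u w, v w) * ux w + gy (u w, v w) * vx w)
    (fun w => gx (u w, v w) * uy w + gy (u w, v w) * vy w).
Proof.
  intros Hg Hu Hv Hm z Dz.
  pose proof (continuous_pair_C _ _ _ (C1_grad_continuous _ _ _ _ _ Hu Dz)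
    (C1_grad_continuous _ _ _ _ _ Hv Dz)) as Hc.
  destruct (Hg _ (Hm z Dz)) as (? & Cx & Cy), (Hu z Dz) as (? & ? & ?),
    (Hv z Dz) as (? & ? & ?).
  pose proof (continuous_comp _ _ _ Hc Cx). pose proof (continuous_comp _ _ _ Hc Cy).
  split; [apply is_grad_comp; assumption|].
  split; apply continuous_Rplus; apply continuous_Rmult; assumption.
Qed.

Lemma C1_grad_comp_derive (D : C -> Prop) (h dh : R -> R) (g gx gy : C -> R) :
  C1_grad D g gx gy ->
  (forall z, D z -> is_derive h (g z) (dh (g z)) /\ continuous dh (g z)) ->
  C1_grad D (fun w => h (g w)) (fun w => dh (g w) * gx w) (fun w => dh (g w) * gy w).
Proof.
  intros Hg Hh z Dz.
  destruct (Hh z Dz) as [H1 H2], (Hg z Dz) as (? & ? & ?).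
  pose proof (continuous_comp _ _ _ (C1_grad_continuous _ _ _ _ _ Hg Dz) H2).
  split; [apply is_grad_comp_derive; assumption|].
  split; apply continuous_Rmult; assumption.
Qed.

Lemma C1_grad_const (D : C -> Prop) (c : R) :
  C1_grad D (fun _ => c) (fun _ => 0) (fun _ => 0).
Proof. intros z _; split; [apply is_grad_const|split; apply continuous_const]. Qed.

Lemma C1_grad_Re (D : C -> Prop) : C1_grad D Re (fun _ => 1) (fun _ => 0).
Proof. intros z _; split; [apply is_grad_Re|split; apply continuous_const]. Qed.

Lemma C1_grad_Im (D : C -> Prop) : C1_grad D Im (fun _ => 0) (fun _ => 1).
Proof. intros z _; split; [apply is_grad_Im|split; apply continuous_const]. Qed.

(** * Holomorphic functions on the unit disk *)

Lemma Cmod_triangle_inv (w z : C) : Rabs (Cmod w - Cmod z) <= Cmod (w - z).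
Proof.
  pose proof (Cmod_triangle (w - z) z) as T1.
  pose proof (Cmod_triangle (z - w) w) as T2.
  replace (w - z + z)%C with w in T1 by ring.
  replace (z - w + w)%C with z in T2 by ring.
  replace (z - w)%C with (- (w - z))%C in T2 by ring.
  rewrite Cmod_opp in T2. apply Rabs_le; lra.
Qed.

Lemma continuous_Cmod (z : C) : continuous Cmod z.
Proof.
  intros P [e He].
  (* A product ball of radius e/2 lies in the modulus ball of radius sqrt 2 * (e/2), and sqrt 2 <
     2. *)
  assert (H2 : 0 < e / 2) by (destruct e; simpl; lra).
  exists (mkposreal _ H2). intros w Hw. apply He.
  apply C_NormedModule_mixin_compat2 in Hw. simpl in Hw.
  assert (Hs : sqrt 2 < 2).
  { replace 2 with (sqrt (2 * 2)) at 2 by (apply sqrt_square; lra). apply sqrt_lt_1; lra. }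
  pose proof (cond_pos e).
  change (Rabs (Cmod w - Cmod z) < e).
  apply Rle_lt_trans with (1 := Cmod_triangle_inv w z).
  apply Rlt_le_trans with (1 := Hw). nra.
Qed.

Lemma disk_open (Rad : Rbar) (z : C) : disk Rad z -> locally z (disk Rad).
Proof.
  unfold disk. destruct Rad as [Rad| |]; simpl; intros Hz.
  - apply (continuous_Cmod z (fun x => x < Rad)). apply open_lt. exact Hz.
  - apply filter_true.
  - destruct Hz.
Qed.

Lemma unit_disk_open (z : C) : unit_disk z -> locally z unit_disk.
Proof. apply disk_open. Qed.

Lemma unit_disk_sqr (z : C) : unit_disk z <-> Re z * Re z + Im z * Im z < 1.
Proof.
  unfold unit_disk, disk, Cmod; simpl; unfold Re, Im.
  rewrite !Rmult_1_r. rewrite <- sqrt_1 at 1.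
  split; intros H.
  - apply sqrt_lt_0_alt; exact H.
  - apply sqrt_lt_1_alt; split; [nra|exact H].
Qed.

(* [dq] is the complex derivative of [q], assumed continuous: the Cauchy-Riemann equations. *)
Definition holo (q dq : C -> C) : Prop :=
  C1_grad unit_disk (fun z => Re (q z)) (fun z => Re (dq z)) (fun z => - Im (dq z)) /\
  C1_grad unit_disk (fun z => Im (q z)) (fun z => Im (dq z)) (fun z => Re (dq z)).

Lemma holo_const (c : C) : holo (fun _ => c) (fun _ => RtoC 0).
Proof.
  split;
  [apply C1_grad_ext with (1 := unit_disk_open) (2 := C1_grad_const _ (Re c))
  |apply C1_grad_ext with (1 := unit_disk_open) (2 := C1_grad_const _ (Im c))];
  intros; unfold Re, Im; simpl; ring.
Qed.

Lemma holo_id : holo (fun z => z) (fun _ => RtoC 1).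
Proof.
  split; [apply C1_grad_ext with (1 := unit_disk_open) (2 := C1_grad_Re _)
         |apply C1_grad_ext with (1 := unit_disk_open) (2 := C1_grad_Im _)];
  intros; unfold Re, Im; simpl; ring.
Qed.

Lemma holo_plus (q dq p dp : C -> C) :
  holo q dq -> holo p dp ->
  holo (fun z => q z + p z)%C (fun z => dq z + dp z)%C.
Proof.
  intros [Q1 Q2] [P1 P2]; split;
  [apply C1_grad_ext with (1 := unit_disk_open) (2 := C1_grad_plus _ _ _ _ _ _ _ Q1 P1)
  |apply C1_grad_ext with (1 := unit_disk_open) (2 := C1_grad_plus _ _ _ _ _ _ _ Q2 P2)];
  intros; unfold Re, Im; simpl; ring.
Qed.

Lemma holo_mult (q dq p dp : C -> C) :
  holo q dq -> holo p dp ->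
  holo (fun z => q z * p z)%C (fun z => dq z * p z + q z * dp z)%C.
Proof.
  intros [Q1 Q2] [P1 P2]; split.
  - apply C1_grad_ext with (1 := unit_disk_open)
      (2 := C1_grad_minus _ _ _ _ _ _ _ (C1_grad_mult _ _ _ _ _ _ _ Q1 P1)
              (C1_grad_mult _ _ _ _ _ _ _ Q2 P2));
    intros; unfold Re, Im; simpl; ring.
  - apply C1_grad_ext with (1 := unit_disk_open)
      (2 := C1_grad_plus _ _ _ _ _ _ _ (C1_grad_mult _ _ _ _ _ _ _ Q1 P2)
              (C1_grad_mult _ _ _ _ _ _ _ Q2 P1));
    intros; unfold Re, Im; simpl; ring.
Qed.

Lemma holo_comp (q dq p dp : C -> C) :
  holo q dq -> holo p dp -> (forall z, unit_disk z -> unit_disk (p z)) ->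
  holo (fun z => q (p z)) (fun z => dq (p z) * dp z)%C.
Proof.
  intros [Q1 Q2] [P1 P2] Hm.
  assert (Hm' : forall z, unit_disk z -> unit_disk (Re (p z), Im (p z)))
    by (intros z Hz; rewrite <- surjective_pairing; auto).
  split;
  [apply C1_grad_ext with (1 := unit_disk_open)
      (2 := C1_grad_comp _ _ _ _ _ _ _ _ _ _ _ Q1 P1 P2 Hm')
  |apply C1_grad_ext with (1 := unit_disk_open)
      (2 := C1_grad_comp _ _ _ _ _ _ _ _ _ _ _ Q2 P1 P2 Hm')];
  intros; unfold Re, Im; simpl; rewrite <- ?surjective_pairing; try ring; reflexivity.
Qed.

(** Real and imaginary parts come from 1/p = conj p / |p|^2. The derivative is written as a product,
    so that [holo_mult] can differentiate it once more in [mobius_holo]. *)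
Lemma holo_inv (p dp : C -> C) :
  holo p dp -> (forall z, unit_disk z -> p z <> RtoC 0) ->
  holo (fun z => / p z)%C (fun z => RtoC (-1) * dp z * (/ p z * / p z))%C.
Proof.
  intros [P1 P2] Hn.
  assert (Hn' : forall z, unit_disk z ->
    Re (p z) * Re (p z) + Im (p z) * Im (p z) <> 0).
  { intros z Hz H. apply (Hn z Hz). rewrite (surjective_pairing (p z)).
    apply injective_projections; simpl; unfold Re, Im in H; nra. }
  assert (HI : forall z, unit_disk z ->
    is_derive Rinv (Re (p z) * Re (p z) + Im (p z) * Im (p z))
      (- / (Re (p z) * Re (p z) + Im (p z) * Im (p z)) ^ 2) /\
    continuous (fun x => - / x ^ 2) (Re (p z) * Re (p z) + Im (p z) * Im (p z))).
  { intros z Hz. specialize (Hn' z Hz). split.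
    - auto_derive; [exact Hn'|]. field; exact Hn'.
    - apply (ex_derive_continuous (V := R_NormedModule)). auto_derive.
      intros H; apply Hn'. nra. }
  pose proof (C1_grad_comp_derive unit_disk Rinv (fun x => - / x ^ 2) _ _ _
    (C1_grad_plus _ _ _ _ _ _ _ (C1_grad_mult _ _ _ _ _ _ _ P1 P1)
              (C1_grad_mult _ _ _ _ _ _ _ P2 P2)) HI) as PI.
  split.
  - apply C1_grad_ext with (1 := unit_disk_open) (2 := C1_grad_mult _ _ _ _ _ _ _ P1 PI);
    intros z Hz; specialize (Hn' z Hz); unfold Re, Im in *; simpl; field;
    intros H; apply Hn'; rewrite <- H; ring.
  - apply C1_grad_ext with (1 := unit_disk_open)
      (2 := C1_grad_minus _ _ _ _ _ _ _ (C1_grad_const _ 0) (C1_grad_mult _ _ _ _ _ _ _ P2 PI));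
    intros z Hz; specialize (Hn' z Hz); unfold Re, Im in *; simpl; field;
    intros H; apply Hn'; rewrite <- H; ring.
Qed.

(* [q] is the holomorphic function E_x - i E_y. *)
Definition harm (E : C -> R) (q : C -> C) : Prop :=
  C1_grad unit_disk E (fun z => Re (q z)) (fun z => - Im (q z)) /\
  exists dq, holo q dq.

(** The chain rule reads (E o p)_x - i (E o p)_y = (q o p) p'. That this product is again
    holomorphic requires p' to be holomorphic. *)
Lemma harm_comp (E : C -> R) (q p dp ddp : C -> C) :
  harm E q -> holo p dp -> holo dp ddp ->
  (forall z, unit_disk z -> unit_disk (p z)) ->
  harm (fun z => E (p z)) (fun z => q (p z) * dp z)%C.
Proof.
  intros [HE [dq Hq]] Hp Hdp Hm. split.
  - assert (Hm' : forall z, unit_disk z -> unit_disk (Re (p z), Im (p z)))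
      by (intros z Hz; rewrite <- surjective_pairing; auto).
    destruct Hp as [P1 P2].
    apply C1_grad_ext with (1 := unit_disk_open)
      (2 := C1_grad_comp _ _ _ _ _ _ _ _ _ _ _ HE P1 P2 Hm');
    intros; unfold Re, Im; simpl; rewrite <- ?surjective_pairing; try ring; reflexivity.
  - eexists. apply holo_mult; [|exact Hdp]. apply (holo_comp _ _ _ _ Hq Hp Hm).
Qed.

(** * Automorphisms of the disk taking 0 to a given point *)

Definition mobius (a z : C) : C := ((z + a) * / (RtoC 1 + Cconj a * z))%C.

(** A zero of the denominator would force Re (conj a z) = -1, hence |z + a|^2 = |z|^2 + |a|^2 - 2 <
    0. *)
Lemma mobius_den (a z : C) : unit_disk a -> unit_disk z ->
  (RtoC 1 + Cconj a * z)%C <> RtoC 0.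
Proof.
  rewrite !unit_disk_sqr. destruct a as [a b], z as [x y]; unfold Re, Im; simpl.
  intros Ha Hz H. injection H; simpl; intros.
  assert (0 <= (x + a) * (x + a) + (y + b) * (y + b)) by nra.
  nra.
Qed.

Lemma mobius_unit_disk (a z : C) : unit_disk a -> unit_disk z -> unit_disk (mobius a z).
Proof.
  intros Ha Hz. pose proof (mobius_den a z Ha Hz) as Hd.
  unfold mobius, unit_disk, disk; simpl.
  rewrite Cmod_mult, Cmod_inv by exact Hd.
  pose proof (proj1 (Cmod_gt_0 _) Hd).
  apply Rmult_lt_reg_r with (Cmod (RtoC 1 + Cconj a * z)); [assumption|].
  rewrite Rmult_assoc, Rinv_l, Rmult_1_r, Rmult_1_l by lra.
  rewrite unit_disk_sqr in Ha, Hz. destruct a as [a b], z as [x y].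
  unfold Re, Im, Cmod in *; simpl in *.
  assert (Hsq : forall t, 0 <= t * (t * 1)) by (intros t; nra).
  apply sqrt_lt_1_alt; split; [apply Rplus_le_le_0_compat; apply Hsq|].
  (* This product is exactly |1 + conj a z|^2 - |z + a|^2. *)
  assert (0 < (1 - (a * a + b * b)) * (1 - (x * x + y * y)))
    by (apply Rmult_lt_0_compat; lra).
  match goal with |- ?l < ?r => apply Rlt_le_trans
    with (l + (1 - (a * a + b * b)) * (1 - (x * x + y * y))); [lra | right; ring] end.
Qed.

(** The derivative at 0 produces the weight 1 - |a|^2 of the gradient estimate; elsewhere only its
    holomorphy matters, for [harm_comp], hence the existential form. *)
Lemma mobius_holo (a : C) : unit_disk a ->
  exists dp ddp, holo (mobius a) dp /\ holo dp ddp /\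
    dp (RtoC 0) = RtoC (1 - Cmod a ^ 2).
Proof.
  intros Ha.
  set (den := fun z : C => (RtoC 1 + Cconj a * z)%C).
  assert (HD : holo den (fun _ => Cconj a)).
  { destruct (holo_plus _ _ _ _ (holo_const (RtoC 1))
      (holo_mult _ _ _ _ (holo_const (Cconj a)) holo_id)) as [H1 H2].
    split; [apply C1_grad_ext with (1 := unit_disk_open) (2 := H1)
           |apply C1_grad_ext with (1 := unit_disk_open) (2 := H2)];
    intros; unfold Re, Im; simpl; ring. }
  assert (HI : holo (fun z => / den z)%C (fun z => RtoC (-1) * Cconj a * (/ den z * / den z))%C)
    by (apply holo_inv; [exact HD | intros; apply mobius_den; assumption]).
  pose proof (holo_plus _ _ _ _ holo_id (holo_const a)) as HN.
  eexists. eexists. split; [exact (holo_mult _ _ _ _ HN HI)|]. split.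
  - exact (holo_plus _ _ _ _
      (holo_mult _ _ _ _ (holo_plus _ _ _ _ (holo_const _) (holo_const _)) HI)
      (holo_mult _ _ _ _ HN (holo_mult _ _ _ _
        (holo_mult _ _ _ _ (holo_const _) (holo_const _)) (holo_mult _ _ _ _ HI HI)))).
  - replace (den (RtoC 0)) with (RtoC 1) by (unfold den; ring).
    rewrite RtoC_minus, Cmod2_conj. field.
Qed.

(** * Integrals over circles *)

Definition polar (s t : R) : C := (s * cos t, s * sin t).

Lemma unit_disk_polar (s t : R) : Rabs s < 1 -> unit_disk (polar s t).
Proof.
  intros Hs. apply unit_disk_sqr. unfold polar, Re, Im; simpl.
  pose proof (sin2_cos2 t) as H. unfold Rsqr in H.
  apply Rabs_def2 in Hs.
  replace (s * cos t * (s * cos t) + s * sin t * (s * sin t))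
    with (s * s * (sin t * sin t + cos t * cos t)) by ring.
  rewrite H. nra.
Qed.

Lemma is_derive_polar_radius (h : C -> R) (s t a b : R) :
  is_grad h (polar s t) a b ->
  is_derive (fun x => h (polar x t)) s (a * cos t + b * sin t).
Proof.
  intros H. apply (is_grad_curve h (fun x => x * cos t) (fun x => x * sin t)); [exact H| |];
  auto_derive; trivial; ring.
Qed.

Lemma is_derive_polar_angle (h : C -> R) (s t a b : R) :
  is_grad h (polar s t) a b ->
  is_derive (fun x => h (polar s x)) t (s * (b * cos t - a * sin t)).
Proof.
  intros H.
  replace (s * (b * cos t - a * sin t)) with (a * (- s * sin t) + b * (s * cos t)) by ring.
  apply (is_grad_curve h (fun x => s * cos x) (fun x => s * sin x)); [exact H| |];
  auto_derive; trivial; ring.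
Qed.

Lemma continuous_polar (s t : R) :
  continuous (fun u : R * R => polar (fst u) (snd u)) (s, t).
Proof.
  apply (continuous_pair_C (U := prod_UniformSpace R_UniformSpace R_UniformSpace)
    (fun u => fst u * cos (snd u)) (fun u => fst u * sin (snd u)));
  apply continuous_Rmult; try apply continuous_fst;
  (apply (continuous_comp snd); [apply continuous_snd|]);
  [apply continuous_cos | apply continuous_sin].
Qed.

Lemma continuous_polar_angle (s t : R) : continuous (fun x => polar s x) t.
Proof.
  apply (continuous_pair_C (fun x => s * cos x) (fun x => s * sin x));
  apply continuous_Rmult; try apply continuous_const;
  [apply continuous_cos | apply continuous_sin].
Qed.

Lemma continuous_circle (g : C -> R) (s t : R) :
  continuous g (polar s t) -> continuous (fun x => g (polar s x)) t.
Proof. apply continuous_comp, continuous_polar_angle. Qed.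

Lemma is_derive_circle_integral (h hx hy : C -> R) (s : R) :
  C1_grad unit_disk h hx hy -> Rabs s < 1 ->
  is_derive (fun s => RInt (fun t => h (polar s t)) (- PI) PI) s
    (RInt (fun t => hx (polar s t) * cos t + hy (polar s t) * sin t) (- PI) PI).
Proof.
  intros Hh Hs.
  assert (Hd : forall u v, Rabs u < 1 -> is_derive (fun x => h (polar x v)) u
     (hx (polar u v) * cos v + hy (polar u v) * sin v)).
  { intros u v Hu. apply is_derive_polar_radius. apply (Hh _ (unit_disk_polar u v Hu)). }
  assert (Hl : locally s (fun u => Rabs u < 1)).
  { apply (continuous_Rabs s (fun x => x < 1)). apply open_lt. exact Hs. }
  replace (RInt (fun t => hx (polar s t) * cos t + hy (polar s t) * sin t) (- PI) PI)
    with (RInt (fun t => Derive (fun u => h (polar u t)) s) (- PI) PI)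
    by (apply RInt_ext; intros; apply is_derive_unique; auto).
  apply is_derive_RInt_param.
  - apply filter_imp with (2 := Hl). intros u Hu t _. eexists; apply Hd; auto.
  - intros t _.
    apply continuity_2d_pt_ext_loc with
      (fun u v => hx (polar u v) * cos v + hy (polar u v) * sin v).
    + destruct Hl as [d Hd']. exists d. intros u v Hu _. symmetry.
      apply is_derive_unique, Hd, Hd'. exact Hu.
    + apply continuity_2d_pt_filterlim.
      destruct (Hh _ (unit_disk_polar s t Hs)) as (_ & Cx & Cy).
      pose proof (continuous_polar s t) as Cp.
      assert (Cc : continuous (fun u : R * R => cos (snd u)) (s, t))
        by (apply (continuous_comp snd); [apply continuous_snd|apply continuous_cos]).
      assert (Cs : continuous (fun u : R * R => sin (snd u)) (s, t))
        by (apply (continuous_comp snd); [apply continuous_snd|apply continuous_sin]).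
      pose proof (continuous_comp (fun u : R * R => polar (fst u) (snd u)) hx (s, t) Cp Cx) as Cx'.
      pose proof (continuous_comp (fun u : R * R => polar (fst u) (snd u)) hy (s, t) Cp Cy) as Cy'.
      exact (continuous_Rplus _ _ _ (continuous_Rmult _ _ _ Cx' Cc)
               (continuous_Rmult _ _ _ Cy' Cs)).
  - apply filter_imp with (2 := Hl). intros u Hu.
    apply (ex_RInt_continuous (V := R_CompleteNormedModule)). intros t _.
    apply (continuous_circle h).
    eapply is_grad_continuous. apply (Hh _ (unit_disk_polar u t Hu)).
Qed.

(** The circle integral is constant in the radius when its derivative vanishes, and at radius 0 it
    is 2 pi h(0). Vanishing is asked only for positive radii because the applications divide by the
    radius. *)
Lemma circle_integral_const (h hx hy : C -> R) (s : R) :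
  C1_grad unit_disk h hx hy ->
  (forall x, 0 < x < 1 ->
    RInt (fun t => hx (polar x t) * cos t + hy (polar x t) * sin t) (- PI) PI = 0) ->
  0 <= s < 1 ->
  RInt (fun t => h (polar s t)) (- PI) PI = 2 * PI * h (RtoC 0).
Proof.
  intros Hh H0 Hs.
  assert (Hd : forall x, 0 <= x <= s -> is_derive
     (fun s => RInt (fun t => h (polar s t)) (- PI) PI) x
     (RInt (fun t => hx (polar x t) * cos t + hy (polar x t) * sin t) (- PI) PI)).
  { intros x Hx. apply is_derive_circle_integral; [exact Hh|]. apply Rabs_def1; lra. }
  destruct (MVT_gen (fun s => RInt (fun t => h (polar s t)) (- PI) PI) 0 s (fun _ => 0))
    as (c & _ & Hc).
  - rewrite Rmin_left, Rmax_right by lra. intros x Hx.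
    rewrite <- (H0 x) by lra. apply Hd; lra.
  - rewrite Rmin_left, Rmax_right by lra. intros x Hx.
    apply derivable_continuous_pt, ex_derive_Reals_0. eexists; apply Hd; lra.
  - rewrite Rmult_0_l in Hc. apply Rminus_diag_uniq in Hc. rewrite Hc.
    rewrite (RInt_ext _ (fun _ => h (RtoC 0))).
    + rewrite RInt_const. unfold scal; simpl; unfold mult; simpl. ring.
    + intros t _. f_equal. unfold polar, RtoC. f_equal; ring.
Qed.

Lemma holo_mean_value (q dq : C -> C) (s : R) :
  holo q dq -> 0 <= s < 1 ->
  RInt (fun t => Re (q (polar s t))) (- PI) PI = 2 * PI * Re (q (RtoC 0)).
Proof.
  intros [H1 H2] Hs.
  apply (circle_integral_const (fun z => Re (q z)) _ _ s H1); [|exact Hs].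
  intros x Hx.
  assert (Hx' : Rabs x < 1) by (apply Rabs_def1; lra).
  (* By Cauchy-Riemann, the integrand is 1/x times the derivative in t of Im q(x e^{it}). *)
  apply is_RInt_unique.
  replace 0 with (minus (/ x * Im (q (polar x PI))) (/ x * Im (q (polar x (- PI))))).
  2:{ unfold polar. rewrite cos_neg, sin_neg, sin_PI, Ropp_0.
      unfold minus, plus, opp; simpl; ring. }
  apply (is_RInt_derive (fun t => / x * Im (q (polar x t)))).
  - intros t _.
    destruct (H2 _ (unit_disk_polar x t Hx')) as [Hg _].
    apply is_derive_polar_angle in Hg.
    apply is_derive_scal with (k := / x) in Hg.
    match goal with |- is_derive _ _ ?r => match type of Hg with is_derive _ _ ?r' =>
      replace r with r' by (field; lra) end end. exact Hg.
  - intros t _.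
    destruct (H1 _ (unit_disk_polar x t Hx')) as (_ & Cx & Cy).
    apply (continuous_circle (fun z => Re (dq z))) in Cx.
    apply (continuous_circle (fun z => - Im (dq z))) in Cy.
    exact (continuous_Rplus _ _ _ (continuous_Rmult _ _ _ Cx (continuous_cos t))
             (continuous_Rmult _ _ _ Cy (continuous_sin t))).
Qed.

Lemma holo_is_RInt (q dq : C -> C) (s : R) :
  holo q dq -> 0 <= s < 1 ->
  is_RInt (fun t => Re (q (polar s t))) (- PI) PI (2 * PI * Re (q (RtoC 0))).
Proof.
  intros Hq Hs. rewrite <- (holo_mean_value q dq s Hq Hs).
  apply (RInt_correct (V := R_CompleteNormedModule)).
  apply (ex_RInt_continuous (V := R_CompleteNormedModule)). intros t _.
  apply (continuous_circle (fun z => Re (q z))).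
  eapply C1_grad_continuous; [apply (proj1 Hq)|].
  apply unit_disk_polar, Rabs_def1; lra.
Qed.

Lemma harm_continuous_circle (E : C -> R) (q : C -> C) (s t : R) :
  harm E q -> Rabs s < 1 -> continuous (fun x => E (polar s x)) t.
Proof.
  intros [HE _] Hs. apply (continuous_circle E).
  eapply C1_grad_continuous; [exact HE|]. apply unit_disk_polar, Hs.
Qed.

(** The radial derivative of E at z = x e^{it} is Re (z q(z)) / x, and the holomorphic function z q
    vanishes at 0, so its mean over the circle is 0. *)
Lemma harm_mean_value (E : C -> R) (q : C -> C) (s : R) :
  harm E q -> 0 <= s < 1 ->
  RInt (fun t => E (polar s t)) (- PI) PI = 2 * PI * E (RtoC 0).
Proof.
  intros [HE [dq Hq]] Hs.
  apply (circle_integral_const E _ _ s HE); [|exact Hs].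
  intros x Hx.
  pose proof (holo_is_RInt _ _ x (holo_mult _ _ _ _ holo_id Hq)) as H.
  apply is_RInt_unique.
  assert (Hx' : 0 <= x < 1) by lra. specialize (H Hx').
  apply (is_RInt_scal _ _ _ (/ x)) in H.
  replace (scal _ _) with 0 in H
    by (unfold scal; simpl; unfold mult; simpl; unfold Re; simpl; ring).
  apply is_RInt_ext with (2 := H). intros t _.
  unfold scal; simpl; unfold mult; simpl. unfold Re, Im; simpl. field; lra.
Qed.

(** Integration by parts in t turns E cos t into minus the tangential derivative of E times sin t.
    That expression is a combination of Re q and Re (z^2 q) on the circle, and z^2 q has mean 0. *)
Lemma harm_first_moment (E : C -> R) (q : C -> C) (s : R) :
  harm E q -> 0 < s < 1 ->
  is_RInt (fun t => E (polar s t) * cos t) (- PI) PI (PI * s * Re (q (RtoC 0))).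
Proof.
  intros HEq Hs. destruct (HEq) as [HE [dq Hq]].
  assert (Hs' : 0 <= s < 1) by lra.
  assert (Has : Rabs s < 1) by (apply Rabs_def1; lra).
  pose proof (holo_is_RInt _ _ s Hq Hs') as I1.
  pose proof (holo_is_RInt _ _ s (holo_mult _ _ _ _ holo_id
    (holo_mult _ _ _ _ holo_id Hq)) Hs') as I2.
  (* The integrand is the t-derivative of E(s e^{it}) sin t, which takes the same value, zero, at
     both ends. *)
  assert (I3 : is_RInt (fun t => s * (- Im (q (polar s t)) * cos t - Re (q (polar s t)) * sin t)
     * sin t + E (polar s t) * cos t) (- PI) PI 0).
  { replace 0 with (minus (E (polar s PI) * sin PI) (E (polar s (- PI)) * sin (- PI))).
    2:{ rewrite sin_neg, sin_PI. unfold minus, plus, opp; simpl; ring. }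
    apply (is_RInt_derive (fun t => E (polar s t) * sin t)).
    - intros t _.
      destruct (HE _ (unit_disk_polar s t Has)) as [Hg _].
      apply is_derive_polar_angle in Hg.
      apply (Derive.is_derive_mult _ sin t _ (cos t) Hg). apply is_derive_sin.
    - intros t _.
      destruct (HE _ (unit_disk_polar s t Has)) as (_ & Cx & Cy).
      apply (continuous_circle (fun z => Re (q z))) in Cx.
      apply (continuous_circle (fun z => - Im (q z))) in Cy.
      pose proof (harm_continuous_circle E q s t HEq Has) as CE.
      exact (continuous_Rplus _ _ _ (continuous_Rmult _ _ _ (continuous_Rmult _ _ _
         (continuous_const s t)
         (continuous_Rminus _ _ _ (continuous_Rmult _ _ _ Cy (continuous_cos t))
            (continuous_Rmult _ _ _ Cx (continuous_sin t)))) (continuous_sin t))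
         (continuous_Rmult _ _ _ CE (continuous_cos t))). }
  (* The weights come from (s/2) Re q - Re (z^2 q)/(2s) = s (Re q sin^2 t + Im q sin t cos t) at z =
     s e^{it}, by the double angle formulas. *)
  apply (is_RInt_scal _ _ _ (s / 2)) in I1.
  apply (is_RInt_scal _ _ _ (- / (2 * s))) in I2.
  pose proof (is_RInt_plus _ _ _ _ _ _ I3 (is_RInt_plus _ _ _ _ _ _ I1 I2)) as I.
  match type of I with is_RInt _ _ _ ?v => replace v with (PI * s * Re (q (RtoC 0))) in I end.
  2:{ unfold plus, scal; simpl; unfold mult; simpl; unfold Re; simpl. field; lra. }
  apply is_RInt_ext with (2 := I). intros t _.
  pose proof (sin2_cos2 t) as Hsc. unfold Rsqr in Hsc.
  unfold plus, scal; simpl; unfold mult; simpl; unfold Re, Im; simpl.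
  field_simplify_eq; [|lra].
  replace (sin t ^ 2) with (1 - cos t ^ 2) by (rewrite <- Hsc; ring).
  ring.
Qed.

(* Bathtub principle: among all h with |h| <= 1 and mean m, the first moment is largest
   for h = 1 on [-alpha, alpha] and h = -1 elsewhere, with alpha = PI/2 + m PI/2. *)
Lemma first_cosine_moment_le (h : R -> R) (m : R) :
  (forall t, continuous h t) -> (forall t, -1 <= h t <= 1) ->
  -1 <= m <= 1 -> RInt h (- PI) PI = 2 * PI * m ->
  RInt (fun t => h t * cos t) (- PI) PI <= 4 * cos (PI / 2 * m).
Proof.
  intros Ch Bh Hm Hmean. pose proof PI_RGT_0 as Hpi.
  set (al := PI / 2 + PI / 2 * m).
  assert (Hal : 0 <= al <= PI) by (unfold al; split; nra).
  (* Subtracting [cos al] costs only a multiple of the known mean, and cos t - cos al changes sign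
     exactly at -al and al, so |h| <= 1 bounds [g] sharply on each of the three pieces. *)
  set (g := fun t => h t * (cos t - cos al)).
  assert (Cg : forall t, continuous g t).
  { intros t. apply continuous_Rmult; [apply Ch|].
    apply continuous_Rminus; [apply continuous_cos|apply continuous_const]. }
  assert (Eg : forall a b, ex_RInt g a b)
    by (intros; apply (ex_RInt_continuous (V := R_CompleteNormedModule)); auto).
  assert (Hin : forall a b, is_RInt (fun t => cos t - cos al) a b
     (sin b - sin a - (b - a) * cos al)).
  { intros a b. replace (sin b - sin a - (b - a) * cos al) with
      (minus (sin b - b * cos al) (sin a - a * cos al))
      by (unfold minus, plus, opp; simpl; ring).
    apply (is_RInt_derive (fun t => sin t - t * cos al)).
    - intros t _. auto_derive; trivial; ring.
    - intros t _. apply continuous_Rminus; [apply continuous_cos|apply continuous_const]. }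
  assert (Hout : forall a b, is_RInt (fun t => cos al - cos t) a b
     (- (sin b - sin a - (b - a) * cos al))).
  { intros a b. apply is_RInt_ext with (fun t => opp (cos t - cos al)).
    - intros; unfold opp; simpl; ring.
    - apply (is_RInt_opp (V := R_NormedModule)), Hin. }
  assert (B1 : RInt g (- PI) (- al) <= - (sin (- al) - sin (- PI) - (- al - - PI) * cos al)).
  { rewrite <- (is_RInt_unique _ _ _ _ (Hout (- PI) (- al))).
    apply RInt_le; [lra|apply Eg|eexists; apply Hout|].
    intros t Ht. unfold g. specialize (Bh t).
    assert (cos t <= cos al).
    { rewrite <- (cos_neg t). apply cos_decr_1; lra. }
    nra. }
  assert (B2 : RInt g (- al) al <= sin al - sin (- al) - (al - - al) * cos al).
  { rewrite <- (is_RInt_unique _ _ _ _ (Hin (- al) al)).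
    apply RInt_le; [lra|apply Eg|eexists; apply Hin|].
    intros t Ht. unfold g. specialize (Bh t).
    assert (cos al <= cos t).
    { destruct (Rle_dec 0 t).
      - apply cos_decr_1; lra.
      - rewrite <- (cos_neg t). apply cos_decr_1; lra. }
    nra. }
  assert (B3 : RInt g al PI <= - (sin PI - sin al - (PI - al) * cos al)).
  { rewrite <- (is_RInt_unique _ _ _ _ (Hout al PI)).
    apply RInt_le; [lra|apply Eg|eexists; apply Hout|].
    intros t Ht. unfold g. specialize (Bh t).
    assert (cos t <= cos al) by (apply cos_decr_1; lra).
    nra. }
  pose proof (RInt_Chasles g (- PI) (- al) al (Eg _ _) (Eg _ _)) as C1.
  pose proof (RInt_Chasles g (- PI) al PI (Eg _ _) (Eg _ _)) as C2.
  unfold plus in C1, C2; simpl in C1, C2.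
  assert (Hh : is_RInt h (- PI) PI (2 * PI * m)).
  { rewrite <- Hmean. apply (RInt_correct (V := R_CompleteNormedModule)).
    apply (ex_RInt_continuous (V := R_CompleteNormedModule)); auto. }
  pose proof (RInt_correct (V := R_CompleteNormedModule) _ _ _ (Eg (- PI) PI)) as Hg.
  apply (is_RInt_scal _ _ _ (cos al)) in Hh.
  pose proof (is_RInt_plus _ _ _ _ _ _ Hg Hh) as HI.
  apply is_RInt_ext with (g := fun t => h t * cos t) in HI.
  2:{ intros t _. unfold g, plus, scal; simpl; unfold mult; simpl; ring. }
  rewrite (is_RInt_unique _ _ _ _ HI).
  unfold plus, scal; simpl; unfold mult; simpl.
  rewrite <- C2, <- C1.
  rewrite !sin_neg, sin_PI in *.
  assert (Hsin : sin al = cos (PI / 2 * m))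
    by (unfold al; rewrite sin_plus, sin_PI2, cos_PI2; ring).
  rewrite <- Hsin.
  (* The three bounds add up to 4 sin al + (2 PI - 4 al) cos al. The choice of [al] gives the
     extremal step function mean [m], so the cos al terms cancel. *)
  assert (Hc : cos al * (2 * PI * m) = cos al * (4 * al - 2 * PI)) by (unfold al; field).
  lra.
Qed.

(** * The gradient estimate *)

Definition unit_bounded (E : C -> R) : Prop := forall z, unit_disk z -> -1 < E z < 1.

Lemma unit_disk_0 : unit_disk (RtoC 0).
Proof. apply unit_disk_sqr. unfold Re, Im; simpl; lra. Qed.

(** Only the x-derivative at 0 is bounded; a rotation in [harm_grad_le] upgrades this to the full
    gradient. The moment formula holds on circles of radius s < 1, so the factor s has to be
    removed. *)
Lemma harm_grad_0 (E : C -> R) (q : C -> C) :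
  harm E q -> unit_bounded E ->
  Re (q (RtoC 0)) <= 4 / PI * cos (PI / 2 * E (RtoC 0)).
Proof.
  intros HE HB. pose proof PI_RGT_0 as Hpi.
  set (X := Re (q (RtoC 0))). set (Y := 4 * cos (PI / 2 * E (RtoC 0))).
  pose proof (HB _ unit_disk_0) as HB0.
  assert (HY : 0 <= Y).
  { unfold Y. apply Rmult_le_pos; [lra|]. apply cos_ge_0; nra. }
  assert (HX : forall s, 0 < s < 1 -> PI * s * X <= Y).
  { intros s Hs. unfold X, Y.
    assert (Has : Rabs s < 1) by (apply Rabs_def1; lra).
    rewrite <- (is_RInt_unique _ _ _ _ (harm_first_moment E q s HE Hs)).
    apply (first_cosine_moment_le (fun t => E (polar s t))).
    - intros t. apply (harm_continuous_circle E q s t HE Has).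
    - intros t. pose proof (HB _ (unit_disk_polar s t Has)); lra.
    - lra.
    - apply (harm_mean_value E q s HE); lra. }
  replace (4 / PI * cos (PI / 2 * E (RtoC 0))) with (Y / PI) by (unfold Y; field; lra).
  apply Rmult_le_reg_l with PI; [exact Hpi|].
  replace (PI * (Y / PI)) with Y by (field; lra).
  destruct (Rle_dec (PI * X) Y) as [H|H]; [exact H|exfalso].
  assert (HPX : 0 < PI * X) by lra.
  assert (Hq : 0 <= Y / (PI * X) < 1).
  { split; [apply Rdiv_le_0_compat; lra|].
    apply Rmult_lt_reg_r with (PI * X); [lra|]. unfold Rdiv.
    rewrite Rmult_assoc, Rinv_l by lra. lra. }
  (* In place of a limit s -> 1: if PI * X exceeded Y, the midpoint of Y/(PI * X) and 1 would be a
     radius s with PI * s * X = (Y + PI * X)/2 > Y. *)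
  specialize (HX ((Y / (PI * X) + 1) / 2)).
  replace (PI * ((Y / (PI * X) + 1) / 2) * X) with ((Y + PI * X) / 2) in HX
    by (field; split; [|lra]; intros ->; lra).
  lra.
Qed.

(** Precomposition with z -> mobius a (eta z) moves a to 0. The unimodular eta turns the new
    gradient at 0 into the positive x-direction, where [harm_grad_0] measures its full length. *)
Lemma harm_grad_le (E : C -> R) (q : C -> C) (a : C) :
  harm E q -> unit_bounded E -> unit_disk a ->
  Cmod (q a) * (1 - Cmod a ^ 2) <= 4 / PI * cos (PI / 2 * E a).
Proof.
  intros HE HB Ha. pose proof PI_RGT_0 as Hpi.
  (* A vanishing gradient has no direction to rotate; the claim then says that the cosine is
     nonnegative. *)
  destruct (Req_dec (Cmod (q a)) 0) as [H0|H0].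
  { rewrite H0, Rmult_0_l. apply Rmult_le_pos.
    - apply Rdiv_le_0_compat; lra.
    - pose proof (HB _ Ha). apply cos_ge_0; nra. }
  assert (Hq : 0 < Cmod (q a)) by (pose proof (Cmod_ge_0 (q a)); lra).
  set (eta := (Cconj (q a) * RtoC (/ Cmod (q a)))%C).
  assert (Heta : Cmod eta = 1).
  { unfold eta. rewrite Cmod_mult, Cmod_R, Cmod_conj, Rabs_pos_eq.
    - field; exact H0.
    - left; apply Rinv_0_lt_compat, Hq. }
  destruct (mobius_holo a Ha) as (dp & ddp & Hp & Hdp & Hdp0).
  assert (Hr1 : holo (fun z => eta * z)%C (fun _ => eta)).
  { destruct (holo_mult _ _ _ _ (holo_const eta) holo_id) as [H1 H2].
    split; [apply C1_grad_ext with (1 := unit_disk_open) (2 := H1)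
           |apply C1_grad_ext with (1 := unit_disk_open) (2 := H2)];
    intros; unfold Re, Im; simpl; ring. }
  assert (Hru : forall z, unit_disk z -> unit_disk (eta * z)%C).
  { intros z Hz. unfold unit_disk, disk in *. rewrite Cmod_mult, Heta, Rmult_1_l. exact Hz. }
  pose proof (harm_comp _ _ _ _ _ HE Hp Hdp (fun z => mobius_unit_disk a z Ha)) as H1.
  pose proof (harm_comp _ _ _ _ _ H1 Hr1 (holo_const eta) Hru) as H2.
  apply harm_grad_0 in H2.
  2:{ intros z Hz. apply HB, mobius_unit_disk, Hru, Hz. exact Ha. }
  replace (eta * RtoC 0)%C with (RtoC 0) in H2 by ring.
  assert (Hm0 : mobius a (RtoC 0) = a) by (unfold mobius; field).
  rewrite Hm0, Hdp0 in H2.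
  apply Rle_trans with (2 := H2). right.
  replace (q a * RtoC (1 - Cmod a ^ 2) * eta)%C
    with (RtoC (Cmod (q a) * (1 - Cmod a ^ 2))); [reflexivity|].
  unfold eta.
  transitivity ((q a * Cconj (q a)) * RtoC (1 - Cmod a ^ 2) * RtoC (/ Cmod (q a)))%C; [|ring].
  rewrite <- Cmod2_conj, <- !RtoC_mult. f_equal. field. exact H0.
Qed.

Lemma harm_opp (E : C -> R) (q : C -> C) :
  harm E q -> harm (fun z => - E z) (fun z => RtoC (-1) * q z)%C.
Proof.
  intros [HE [dq Hq]]. split.
  - apply C1_grad_ext with (1 := unit_disk_open)
      (2 := C1_grad_minus _ _ _ _ _ _ _ (C1_grad_const _ 0) HE);
    intros; unfold Re, Im; simpl; ring.
  - eexists; apply holo_mult; [apply holo_const|exact Hq].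
Qed.

(** * Integrating the gradient estimate along radii *)

Lemma unit_disk_scal (z : C) (t : R) : unit_disk z -> 0 <= t <= 1 ->
  unit_disk (t * Re z, t * Im z) /\ Cmod (t * Re z, t * Im z) = t * Cmod z.
Proof.
  intros Hz Ht.
  assert (Hm : Cmod (t * Re z, t * Im z) = t * Cmod z).
  { replace (t * Re z, t * Im z) with (RtoC t * z)%C
      by (unfold Re, Im, RtoC, Cmult; simpl; f_equal; ring).
    rewrite Cmod_mult, Cmod_R, Rabs_pos_eq; lra. }
  split; [|exact Hm].
  unfold unit_disk, disk in *; simpl in *. rewrite Hm.
  pose proof (Cmod_ge_0 z). nra.
Qed.

(** The last factor is the hyperbolic speed of t -> t z. The cosine is kept here because
    [harm_le_atan] divides by it. *)
Lemma harm_radial_derive (E : C -> R) (q : C -> C) (z : C) (t : R) :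
  harm E q -> unit_bounded E -> unit_disk z -> 0 <= t <= 1 ->
  exists l, is_derive (fun t => E (t * Re z, t * Im z)) t l /\
    l <= 4 / PI * cos (PI / 2 * E (t * Re z, t * Im z)) * (Cmod z / (1 - (t * Cmod z) ^ 2)).
Proof.
  intros HE HB Hz Ht.
  destruct (unit_disk_scal z t Hz Ht) as [Hu Hm].
  set (w := (t * Re z, t * Im z)) in *.
  exists (Re (q w * z)%C). split.
  - destruct HE as [HE _]. destruct (HE w Hu) as [Hg _].
    replace (Re (q w * z)%C) with (Re (q w) * Re z + - Im (q w) * Im z)
      by (unfold Re, Im; simpl; ring).
    apply (is_grad_curve E (fun t => t * Re z) (fun t => t * Im z)); [exact Hg| |];
    auto_derive; trivial; ring.
  - pose proof (harm_grad_le E q w HE HB Hu) as Hq. rewrite Hm in Hq.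
    assert (Hd : 0 < 1 - (t * Cmod z) ^ 2).
    { unfold unit_disk, disk in Hu; simpl in Hu. rewrite Hm in Hu.
      pose proof (Cmod_ge_0 z). assert (0 <= t * Cmod z) by nra. nra. }
    apply Rle_trans with (Cmod (q w) * Cmod z).
    { rewrite <- Cmod_mult. apply Rle_trans with (1 := Rle_abs _). apply re_le_Cmod. }
    apply Rle_trans with ((Cmod (q w) * (1 - (t * Cmod z) ^ 2))
      * (Cmod z / (1 - (t * Cmod z) ^ 2))).
    { right. field. lra. }
    apply Rmult_le_compat_r; [|exact Hq].
    apply Rdiv_le_0_compat; [apply Cmod_ge_0|exact Hd].
Qed.

Lemma nonpos_derive_le (k : R -> R) :
  (forall t, 0 <= t <= 1 -> exists l, is_derive k t l /\ l <= 0) -> k 1 <= k 0.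
Proof.
  intros H.
  destruct (MVT_gen k 0 1 (Derive k)) as (c & Hc & Heq).
  - rewrite Rmin_left, Rmax_right by lra. intros x Hx.
    destruct (H x) as (l & Hl & _); [lra|]. apply Derive_correct. eexists; exact Hl.
  - rewrite Rmin_left, Rmax_right by lra. intros x Hx.
    destruct (H x Hx) as (l & Hl & _).
    apply derivable_continuous_pt, ex_derive_Reals_0. eexists; exact Hl.
  - rewrite Rmin_left, Rmax_right in Hc by lra.
    destruct (H c Hc) as (l & Hl & Hl0). apply is_derive_unique in Hl. rewrite Hl in Heq. lra.
Qed.

(** With the cosine bounded by 1, the right side is the derivative of (4/pi) artanh(t |z|). The
    value at 0 stays arbitrary because the lemma is applied after a change of base point. *)
Lemma harm_sub_le_artanh (E : C -> R) (q : C -> C) (z : C) :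
  harm E q -> unit_bounded E -> unit_disk z ->
  E z - E (RtoC 0) <= 4 / PI * artanh (Cmod z).
Proof.
  intros HE HB Hz. pose proof PI_RGT_0 as Hpi.
  set (m := Cmod z). assert (Hm : 0 <= m < 1) by (split; [apply Cmod_ge_0|exact Hz]).
  assert (K : forall t, 0 <= t <= 1 -> exists l, is_derive (fun t => E (t * Re z, t * Im z)
      - 4 / PI * (/ 2 * (ln (1 + t * m) - ln (1 - t * m)))) t l /\ l <= 0).
  { intros t Ht.
    destruct (harm_radial_derive E q z t HE HB Hz Ht) as (l & Hl & Hle). fold m in Hle.
    assert (Htm : 0 <= t * m < 1) by nra.
    exists (l - 4 / PI * (m / (1 - (t * m) ^ 2))). split.
    - apply (is_derive_minus (V := R_NormedModule)); [exact Hl|].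
      auto_derive; [lra|]. field. repeat split; nra.
    - assert (0 <= m / (1 - (t * m) ^ 2)) by (apply Rdiv_le_0_compat; nra).
      assert (Hf : 0 < 4 / PI) by (apply Rdiv_lt_0_compat; lra).
      pose proof (COS_bound (PI / 2 * E (t * Re z, t * Im z))) as [_ Hc].
      assert (4 / PI * cos (PI / 2 * E (t * Re z, t * Im z)) * (m / (1 - (t * m) ^ 2))
        <= 4 / PI * 1 * (m / (1 - (t * m) ^ 2))).
      { apply Rmult_le_compat_r; [assumption|]. apply Rmult_le_compat_l; lra. }
      lra. }
  apply nonpos_derive_le in K.
  rewrite !Rmult_1_l, !Rmult_0_l, Rminus_0_r, Rplus_0_r, ln_1 in K.
  change (Re z, Im z) with (fst z, snd z) in K. rewrite <- surjective_pairing in K.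
  change (0, 0) with (RtoC 0) in K.
  unfold artanh. fold m. rewrite ln_div by lra. lra.
Qed.

(** Separation of variables for u' <= (4/pi) cos(pi u/2) m/(1 - t^2 m^2). With x = pi u/4, an
    antiderivative of (pi/2)/cos(pi u/2) is ln((cos x + sin x)/(cos x - sin x)), to be compared with
    ln((1 + tm)/(1 - tm)); at t = 1 this says tan x <= m. *)
Lemma harm_le_atan (E : C -> R) (q : C -> C) (z : C) :
  harm E q -> unit_bounded E -> E (RtoC 0) = 0 -> unit_disk z ->
  E z <= 4 / PI * atan (Cmod z).
Proof.
  intros HE HB H0 Hz. pose proof PI_RGT_0 as Hpi.
  set (m := Cmod z). assert (Hm : 0 <= m < 1) by (split; [apply Cmod_ge_0|exact Hz]).
  (* Keeps the arguments of both logarithms positive; it amounts to |tan| < 1 on (-pi/4, pi/4). *)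
  assert (HX : forall e, -1 < e < 1 -> - cos (PI / 4 * e) < sin (PI / 4 * e) < cos (PI / 4 * e)).
  { intros e He.
    assert (Hc : 0 < cos (PI / 4 * e)) by (apply cos_gt_0; nra).
    assert (Hc2 : 0 < cos (2 * (PI / 4 * e))) by (apply cos_gt_0; nra).
    rewrite cos_2a in Hc2. split; nra. }
  assert (K : forall t, 0 <= t <= 1 -> exists l, is_derive (fun t =>
      ln (cos (PI / 4 * E (t * Re z, t * Im z)) + sin (PI / 4 * E (t * Re z, t * Im z)))
      - ln (cos (PI / 4 * E (t * Re z, t * Im z)) - sin (PI / 4 * E (t * Re z, t * Im z)))
      - (ln (1 + t * m) - ln (1 - t * m))) t l /\ l <= 0).
  { intros t Ht.
    destruct (harm_radial_derive E q z t HE HB Hz Ht) as (l & Hl & Hle). fold m in Hle.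
    destruct (unit_disk_scal z t Hz Ht) as [Hu _].
    pose proof (HX _ (HB _ Hu)) as Hcs.
    assert (Htm : 0 <= t * m < 1) by nra.
    set (u := fun t => E (t * Re z, t * Im z)) in *.
    change (E (t * Re z, t * Im z)) with (u t) in *.
    assert (Hc2 : cos (PI / 2 * u t) = cos (PI / 4 * u t) ^ 2 - sin (PI / 4 * u t) ^ 2).
    { replace (PI / 2 * u t) with (2 * (PI / 4 * u t)) by field. rewrite cos_2a. ring. }
    assert (Hc2p : 0 < cos (PI / 2 * u t)) by (rewrite Hc2; nra).
    change (exists l, is_derive (fun t => ln (cos (PI / 4 * u t) + sin (PI / 4 * u t)) -
      ln (cos (PI / 4 * u t) - sin (PI / 4 * u t)) - (ln (1 + t * m) - ln (1 - t * m))) t l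
      /\ l <= 0).
    change (is_derive u t l) in Hl. clearbody u.
    exists (PI / 2 * l / cos (PI / 2 * u t) - 2 * (m / (1 - (t * m) ^ 2))). split.
    - apply (is_derive_minus (V := R_NormedModule)).
      + auto_derive.
        * repeat split; try lra; eexists; exact Hl.
        * replace (Derive (fun x : R => u x) t) with (l : R)
            by (symmetry; exact (is_derive_unique u t l Hl)).
          rewrite Hc2.
          pose proof (sin2_cos2 (PI / 4 * u t)) as Hsc. unfold Rsqr in Hsc.
          set (c := cos (PI / 4 * u t)) in *. set (s := sin (PI / 4 * u t)) in *.
          (* Adding the two logarithmic derivatives leaves s^2 + c^2 in the numerator, which is
             1. *)
          transitivity (PI / 2 * l * (s * s + c * c) / (c ^ 2 - s ^ 2)).
          { field. repeat split; nra. }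
          rewrite Hsc, Rmult_1_r. reflexivity.
      + auto_derive; [lra|]. field. repeat split; nra.
    - apply Rle_minus.
      apply Rmult_le_reg_r with (cos (PI / 2 * u t) * (2 / PI)).
      { apply Rmult_lt_0_compat; [lra|]. apply Rdiv_lt_0_compat; lra. }
      apply Rle_trans with l; [right; field; lra|].
      apply Rle_trans with (1 := Hle). right. field. split; [lra|nra]. }
  apply nonpos_derive_le in K.
  rewrite !Rmult_1_l, !Rmult_0_l, Rminus_0_r, Rplus_0_r, ln_1 in K.
  change (Re z, Im z) with (fst z, snd z) in K. rewrite <- surjective_pairing in K.
  change (0, 0) with (RtoC 0) in K.
  rewrite H0, Rmult_0_r, cos_0, sin_0, Rplus_0_r, !Rminus_0_r, ln_1 in K.
  pose proof (HX _ (HB _ Hz)) as Hcs.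
  set (x := PI / 4 * E z) in *.
  assert (Hx : tan x <= m).
  { rewrite <- !ln_div, Rminus_diag in K by lra.
    assert (Hln : (cos x + sin x) / (cos x - sin x) <= (1 + m) / (1 - m)).
    { apply Rnot_lt_le. intros Hlt. apply ln_increasing in Hlt; [lra|].
      apply Rdiv_lt_0_compat; lra. }
    apply Rmult_le_compat_r with (r := (cos x - sin x) * (1 - m)) in Hln; [|nra].
    replace ((cos x + sin x) / (cos x - sin x) * ((cos x - sin x) * (1 - m)))
      with ((cos x + sin x) * (1 - m)) in Hln by (field; lra).
    replace ((1 + m) / (1 - m) * ((cos x - sin x) * (1 - m)))
      with ((cos x - sin x) * (1 + m)) in Hln by (field; lra).
    unfold tan. apply Rmult_le_reg_r with (cos x); [lra|].
    unfold Rdiv. rewrite Rmult_assoc, Rinv_l by lra. lra. }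
  assert (Hxa : x <= atan m).
  { pose proof (HB _ Hz). rewrite <- (atan_tan x) by (unfold x; nra).
    destruct Hx as [Hx|Hx]; [left; apply atan_increasing, Hx|rewrite Hx; right; reflexivity]. }
  apply Rmult_le_reg_l with (PI / 4); [lra|].
  replace (PI / 4 * (4 / PI * atan m)) with (atan m) by (field; lra). exact Hxa.
Qed.

(** * Radial metrics *)

Lemma disk_le (Rad : Rbar) (w z : C) : disk Rad w -> Cmod z <= Cmod w -> disk Rad z.
Proof. intros Hw Hz. exact (Rbar_le_lt_trans (Cmod z) (Cmod w) Rad Hz Hw). Qed.

Lemma continuous_RtoC (x : R) : continuous RtoC x.
Proof.
  apply (continuous_pair_C (fun y => y) (fun _ => 0));
    [apply continuous_id|apply continuous_const].
Qed.

Definition radial_primitive (rho : C -> R) (x : R) : R :=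
  RInt (fun s => rho (RtoC s)) 0 x.

Lemma metric_C1_grad (Rad : Rbar) (rho : C -> R) :
  conformal_metric (disk Rad) rho -> C1_grad (disk Rad) rho (pdx rho) (pdy rho).
Proof. intros Hrho. apply C1_grad_of_C1_on; [apply disk_open|apply Hrho]. Qed.

Lemma metric_axis_continuous (Rad : Rbar) (rho : C -> R) (x : R) :
  conformal_metric (disk Rad) rho -> disk Rad (RtoC x) ->
  continuous (fun s => rho (RtoC s)) x.
Proof.
  intros Hrho Hx. apply (continuous_comp RtoC rho); [apply continuous_RtoC|].
  apply C1_grad_continuous with (1 := metric_C1_grad Rad rho Hrho), Hx.
Qed.

Lemma metric_axis_derive (Rad : Rbar) (rho : C -> R) (x : R) :
  conformal_metric (disk Rad) rho -> disk Rad (RtoC x) ->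
  is_derive (fun s => rho (RtoC s)) x (pdx rho (RtoC x)) /\
  continuous (fun s => pdx rho (RtoC s)) x.
Proof.
  intros Hrho Hx. destruct (metric_C1_grad Rad rho Hrho _ Hx) as (Hg & Cx & _). split.
  - apply (is_grad_pdx _ _ _ _ Hg).
  - apply (continuous_comp RtoC (pdx rho)); [apply continuous_RtoC|exact Cx].
Qed.

Lemma disk_segment_0 (Rad : Rbar) (x s : R) :
  disk Rad (RtoC x) -> Rmin 0 x <= s <= Rmax 0 x -> disk Rad (RtoC s).
Proof.
  intros Hx Hs. apply disk_le with (1 := Hx). rewrite !Cmod_R.
  unfold Rmin, Rmax in Hs. destruct (Rle_dec 0 x); unfold Rabs; do 2 destruct Rcase_abs; lra.
Qed.

Lemma disk_0 (Rad : Rbar) (w : C) : disk Rad w -> disk Rad (RtoC 0).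
Proof. intros Hw. apply disk_le with (1 := Hw). rewrite Cmod_0. apply Cmod_ge_0. Qed.

Lemma ex_RInt_metric_axis (Rad : Rbar) (rho : C -> R) (x y : R) :
  conformal_metric (disk Rad) rho -> disk Rad (RtoC x) -> disk Rad (RtoC y) ->
  ex_RInt (fun s => rho (RtoC s)) x y.
Proof.
  intros Hrho Hx Hy.
  assert (H : forall z, disk Rad (RtoC z) -> ex_RInt (fun s => rho (RtoC s)) 0 z).
  { intros z Hz. apply (ex_RInt_continuous (V := R_CompleteNormedModule)).
    intros s Hs. apply (metric_axis_continuous Rad); [exact Hrho|].
    apply disk_segment_0 with (1 := Hz) (2 := Hs). }
  apply ex_RInt_Chasles with 0; [apply ex_RInt_swap|]; auto.
Qed.

Lemma radial_primitive_derive (Rad : Rbar) (rho : C -> R) (x : R) :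
  conformal_metric (disk Rad) rho -> disk Rad (RtoC x) ->
  is_derive (radial_primitive rho) x (rho (RtoC x)).
Proof.
  intros Hrho Hx.
  apply (is_derive_RInt (V := R_NormedModule) (fun s => rho (RtoC s)) (radial_primitive rho) 0).
  - apply filter_imp with (fun y => disk Rad (RtoC y));
      [|exact (continuous_RtoC x _ (disk_open _ _ Hx))].
    intros y Hy. apply (RInt_correct (V := R_CompleteNormedModule)).
    apply (ex_RInt_metric_axis Rad); [exact Hrho|exact (disk_0 _ _ Hx)|exact Hy].
  - apply (metric_axis_continuous Rad); assumption.
Qed.

Lemma metric_axis_even (Rad : Rbar) (rho : C -> R) (x : R) :
  radial (disk Rad) rho -> disk Rad (RtoC x) -> rho (RtoC (Rabs x)) = rho (RtoC x).
Proof. intros Hradial Hx. rewrite (Hradial (RtoC x) Hx), Cmod_R. reflexivity. Qed.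

(** The primitive is odd by the substitution s -> -s, since [rho] is even on the real axis;
    positivity of [rho] then fixes the sign. *)
Lemma radial_primitive_abs (Rad : Rbar) (rho : C -> R) (x : R) :
  conformal_metric (disk Rad) rho -> radial (disk Rad) rho -> disk Rad (RtoC x) ->
  radial_primitive rho (Rabs x) = Rabs (radial_primitive rho x).
Proof.
  intros Hrho Hradial Hx. unfold radial_primitive.
  assert (Hpos : forall a, 0 <= a -> disk Rad (RtoC a) ->
    0 <= RInt (fun s => rho (RtoC s)) 0 a).
  { intros a Ha Da. apply RInt_ge_0; [exact Ha| |].
    - apply (ex_RInt_metric_axis Rad); [exact Hrho|exact (disk_0 _ _ Da)|exact Da].
    - intros s Hs. left. apply Hrho. apply disk_segment_0 with a; [exact Da|].
      rewrite Rmin_left, Rmax_right; lra. }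
  destruct (Rle_dec 0 x) as [H|H].
  - rewrite (Rabs_pos_eq x H). rewrite Rabs_pos_eq; auto.
  - rewrite (Rabs_left x) by lra.
    assert (Hx' : disk Rad (RtoC (- x))).
    { apply disk_le with (1 := Hx). rewrite !Cmod_R, Rabs_Ropp; lra. }
    assert (HI : RInt (fun s => rho (RtoC s)) 0 x = - RInt (fun s => rho (RtoC s)) 0 (- x)).
    { assert (He : is_RInt (fun s => rho (RtoC s)) (- 0) (- - x)
        (RInt (fun s => rho (RtoC s)) 0 x)).
      { rewrite Ropp_0, Ropp_involutive. apply (RInt_correct (V := R_CompleteNormedModule)).
        apply (ex_RInt_metric_axis Rad); [exact Hrho|exact (disk_0 _ _ Hx)|exact Hx]. }
      apply (is_RInt_comp_opp (V := R_NormedModule)) in He.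
      apply (is_RInt_opp (V := R_NormedModule)) in He.
      rewrite <- (Ropp_involutive (RInt _ 0 x)). f_equal. symmetry. apply is_RInt_unique.
      apply is_RInt_ext with (2 := He). intros s Hs. rewrite opp_opp.
      assert (Ds : disk Rad (RtoC s)) by (apply disk_segment_0 with (- x); [exact Hx'|lra]).
      assert (Ds' : disk Rad (RtoC (- s)))
        by (apply disk_le with (1 := Ds); rewrite !Cmod_R, Rabs_Ropp; lra).
      rewrite <- (metric_axis_even Rad rho s Hradial Ds),
        <- (metric_axis_even Rad rho _ Hradial Ds'), Rabs_Ropp. reflexivity. }
    rewrite HI, Rabs_Ropp, Rabs_pos_eq; [reflexivity|]. apply Hpos; [lra|exact Hx'].
Qed.

(** * The equation of real rho-harmonic functions *)

Lemma pdx_log_metric (Rad : Rbar) (rho : C -> R) (x : R) :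
  conformal_metric (disk Rad) rho -> disk Rad (RtoC x) ->
  pdx (fun w => ln (rho w ^ 2)) (RtoC x) = 2 * pdx rho (RtoC x) / rho (RtoC x).
Proof.
  intros Hrho Hx. pose proof (proj2 Hrho _ Hx) as Hp.
  apply is_derive_unique.
  destruct (metric_axis_derive Rad rho x Hrho Hx) as [Hd _].
  set (k := fun s => rho (RtoC s)) in *.
  change (is_derive (fun s => ln (k s ^ 2)) x (2 * pdx rho (RtoC x) / k x)).
  assert (Hk : 0 < k x) by exact Hp.
  change (is_derive k x (pdx rho (RtoC x))) in Hd.
  generalize dependent (pdx rho (RtoC x)). clear Hp. clearbody k. intros l Hd.
  auto_derive.
  - repeat split; [eexists; exact Hd|]. nra.
  - replace (Derive (fun x : R => k x) x) with (l : R)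
      by (symmetry; exact (is_derive_unique k x l Hd)).
    field. lra.
Qed.

Lemma pdx_const (c : R) (z : C) : pdx (fun _ => c) z = 0.
Proof. exact (Derive_const c _). Qed.

Lemma pdy_const (c : R) (z : C) : pdy (fun _ => c) z = 0.
Proof. exact (Derive_const c _). Qed.

Lemma dz_RtoC (f : C -> R) (z : C) :
  dz (fun w => RtoC (f w)) z = (pdx f z / 2, - (pdy f z / 2)).
Proof.
  unfold dz, Cpdx, Cpdy.
  change (pdx (fun w => Im (RtoC (f w))) z) with (pdx (fun _ => 0) z).
  change (pdy (fun w => Im (RtoC (f w))) z) with (pdy (fun _ => 0) z).
  change (pdx (fun w => Re (RtoC (f w))) z) with (pdx f z).
  change (pdy (fun w => Re (RtoC (f w))) z) with (pdy f z).
  rewrite pdx_const, pdy_const.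
  apply injective_projections; simpl; field.
Qed.

Lemma dzbar_RtoC (f : C -> R) (z : C) :
  dzbar (fun w => RtoC (f w)) z = (pdx f z / 2, pdy f z / 2).
Proof.
  unfold dzbar, Cpdx, Cpdy.
  change (pdx (fun w => Im (RtoC (f w))) z) with (pdx (fun _ => 0) z).
  change (pdy (fun w => Im (RtoC (f w))) z) with (pdy (fun _ => 0) z).
  change (pdx (fun w => Re (RtoC (f w))) z) with (pdx f z).
  change (pdy (fun w => Re (RtoC (f w))) z) with (pdy f z).
  rewrite pdx_const, pdy_const.
  apply injective_projections; simpl; field.
Qed.

Lemma pdx_scal (g h : C -> R) (c : R) (z : C) :
  (forall w, g w = c * h w) -> pdx g z = c * pdx h z.
Proof.
  intros H. unfold pdx. rewrite <- Derive_scal. apply Derive_ext. intros; apply H.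
Qed.

Lemma pdy_scal (g h : C -> R) (c : R) (z : C) :
  (forall w, g w = c * h w) -> pdy g z = c * pdy h z.
Proof.
  intros H. unfold pdy. rewrite <- Derive_scal. apply Derive_ext. intros; apply H.
Qed.

Lemma pd_swap (f : C -> R) (z : C) :
  C2_on unit_disk f -> unit_disk z -> pdx (pdy f) z = pdy (pdx f) z.
Proof.
  intros (H1 & Hx & Hy) Hz. destruct z as [x y].
  apply (Schwarz (fun x y => f (x, y)) x y).
  - apply locally_2d_locally. apply filter_imp with (2 := unit_disk_open _ Hz).
    intros [u v] Hw.
    destruct (H1 _ Hw) as (? & ? & _), (Hx _ Hw) as (_ & ? & _), (Hy _ Hw) as (? & _).
    repeat split; assumption.
  - apply continuity_2d_pt_filterlim.
    destruct (Hy _ Hz) as (_ & _ & Hc & _).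
    apply continuous_ext with (2 := Hc). intros [u v]; reflexivity.
  - apply continuity_2d_pt_filterlim.
    destruct (Hx _ Hz) as (_ & _ & _ & Hc).
    apply continuous_ext with (2 := Hc). intros [u v]; reflexivity.
Qed.

(** The left side is the Laplacian of G o f, as G' = rho and G'' = rho_x on the real axis. For real
    f the product f_z f_zbar equals |grad f|^2/4, so the real part of the equation involves log
    rho^2 through its x-derivative; multiplying by 4 rho clears denominators. *)
Lemma rho_harmonic_real (Rad : Rbar) (rho : C -> R) (f : C -> R) (z : C) :
  conformal_metric (disk Rad) rho ->
  rho_harmonic (disk Rad) rho (fun z => RtoC (f z)) -> unit_disk z ->
  rho (RtoC (f z)) * (pdx (pdx f) z + pdy (pdy f) z)
    + pdx rho (RtoC (f z)) * (pdx f z ^ 2 + pdy f z ^ 2) = 0.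
Proof.
  intros Hrho (_ & _ & HD & Heq) Hz.
  specialize (HD z Hz). specialize (Heq z Hz).
  pose proof (proj2 Hrho _ HD) as Hp.
  rewrite dz_RtoC, dzbar_RtoC, dz_RtoC in Heq.
  rewrite (pdx_log_metric Rad rho _ Hrho HD) in Heq.
  apply (f_equal Re) in Heq. unfold dzbar, Cpdx, Cpdy in Heq.
  rewrite (pdx_scal (fun w => Re (dz (fun w => RtoC (f w)) w)) (pdx f) (/ 2)) in Heq
    by (intros w; rewrite dz_RtoC; simpl; field).
  rewrite (pdx_scal (fun w => Im (dz (fun w => RtoC (f w)) w)) (pdy f) (- / 2)) in Heq
    by (intros w; rewrite dz_RtoC; simpl; field).
  rewrite (pdy_scal (fun w => Re (dz (fun w => RtoC (f w)) w)) (pdx f) (/ 2)) in Heq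
    by (intros w; rewrite dz_RtoC; simpl; field).
  rewrite (pdy_scal (fun w => Im (dz (fun w => RtoC (f w)) w)) (pdy f) (- / 2)) in Heq
    by (intros w; rewrite dz_RtoC; simpl; field).
  unfold Re in Heq; simpl in Heq.
  match type of Heq with ?l = _ =>
    replace (rho (RtoC (f z)) * (pdx (pdx f) z + pdy (pdy f) z)
    + pdx rho (RtoC (f z)) * (pdx f z ^ 2 + pdy f z ^ 2)) with (4 * rho (RtoC (f z)) * l)
  end.
  - rewrite Heq. ring.
  - field. lra.
Qed.

Lemma rho_harmonic_harm (Rad : Rbar) (rho : C -> R) (f : C -> R) (c : R) :
  conformal_metric (disk Rad) rho ->
  rho_harmonic (disk Rad) rho (fun z => RtoC (f z)) ->
  harm (fun z => c * radial_primitive rho (f z))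
    (fun z => (c * rho (RtoC (f z)) * pdx f z, - (c * rho (RtoC (f z)) * pdy f z))).
Proof.
  intros Hrho Hf.
  pose proof Hf as (Hf2 & _ & HD & _).
  change (C2_on unit_disk f) in Hf2.
  pose proof Hf2 as (H1 & Hx & Hy).
  apply (C1_grad_of_C1_on _ _ unit_disk_open) in H1.
  apply (C1_grad_of_C1_on _ _ unit_disk_open) in Hx.
  apply (C1_grad_of_C1_on _ _ unit_disk_open) in Hy.
  assert (HG : forall z, unit_disk z ->
    is_derive (fun x => c * radial_primitive rho x) (f z) (c * rho (RtoC (f z))) /\
    continuous (fun x => c * rho (RtoC x)) (f z)).
  { intros z Hz. split.
    - apply (is_derive_scal (fun x => radial_primitive rho x)).
      apply (radial_primitive_derive Rad); [exact Hrho|exact (HD z Hz)].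
    - apply continuous_Rmult; [apply continuous_const|].
      apply (metric_axis_continuous Rad); [exact Hrho|exact (HD z Hz)]. }
  assert (HA : forall z, unit_disk z ->
    is_derive (fun x => c * rho (RtoC x)) (f z) (c * pdx rho (RtoC (f z))) /\
    continuous (fun x => c * pdx rho (RtoC x)) (f z)).
  { intros z Hz. destruct (metric_axis_derive Rad rho _ Hrho (HD z Hz)) as [Hd Hc].
    split.
    - apply (is_derive_scal (fun x => rho (RtoC x))), Hd.
    - apply continuous_Rmult; [apply continuous_const|exact Hc]. }
  pose proof (C1_grad_comp_derive _ (fun x => c * radial_primitive rho x)
    (fun x => c * rho (RtoC x)) _ _ _ H1 HG) as CE.
  pose proof (C1_grad_comp_derive _ (fun x => c * rho (RtoC x))
    (fun x => c * pdx rho (RtoC x)) _ _ _ H1 HA) as CA.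
  pose proof (C1_grad_mult _ _ _ _ _ _ _ CA Hx) as C1.
  pose proof (C1_grad_minus _ _ _ _ _ _ _ (C1_grad_const _ 0)
     (C1_grad_mult _ _ _ _ _ _ _ CA Hy)) as C2.
  split.
  - apply C1_grad_ext with (1 := unit_disk_open) (2 := CE);
    intros; unfold Re, Im; simpl; ring.
  - exists (fun z => (c * pdx rho (RtoC (f z)) * pdx f z * pdx f z
                + c * rho (RtoC (f z)) * pdx (pdx f) z,
              - (c * pdx rho (RtoC (f z)) * pdx f z * pdy f z
                + c * rho (RtoC (f z)) * pdx (pdy f) z))).
    split.
    + apply C1_grad_ext with (1 := unit_disk_open) (2 := C1);
      intros z Hz; unfold Re, Im; simpl; [reflexivity|reflexivity|].
      (* One Cauchy-Riemann equation is the symmetry of the mixed derivatives of f. *)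
      rewrite (pd_swap f z Hf2 Hz). ring.
    + apply C1_grad_ext with (1 := unit_disk_open) (2 := C2);
      intros z Hz; unfold Re, Im; simpl; [ring|ring|].
      (* The other one is the vanishing of the Laplacian, multiplied by -c. *)
      pose proof (rho_harmonic_real Rad rho f z Hrho Hf Hz) as Heq.
      apply Rminus_diag_uniq.
      match type of Heq with ?l = _ => transitivity (- c * l) end; [ring|rewrite Heq; ring].
Qed.

(** * Lengths of curves *)

(** Monotonicity from local comparison with each single point, by a supremum argument. It stands in
    for the mean value theorem where [u] has no derivative. *)
Lemma locally_nondecreasing_le (u : R -> R) (a b : R) :
  a <= b ->
  (forall x, a <= x <= b ->
     locally x (fun y => a <= y <= b -> 0 <= (u y - u x) * (y - x))) ->
  u a <= u b.
Proof.
  intros Hab Hloc.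
  set (S := fun x => a <= x <= b /\ u a <= u x).
  destruct (completeness S) as [c [Hub Hlub]].
  { exists b. intros x [Hx _]; lra. }
  { exists a. split; lra. }
  assert (Hac : a <= c) by (apply Hub; split; lra).
  assert (Hcb : c <= b) by (apply Hlub; intros x [Hx _]; lra).
  destruct (Hloc c) as [[d Hd] Hball]; [lra|].
  assert (HB : forall y, Rabs (y - c) < d -> a <= y <= b -> 0 <= (u y - u c) * (y - c))
    by exact Hball.
  (* Otherwise a point x of S within d to the left of c would satisfy u x <= u c < u a, so c - d
     would already bound S. *)
  assert (Sc : u a <= u c).
  { destruct (Rle_dec (u a) (u c)) as [H|H]; [exact H|exfalso].
    assert (Hle : c <= c - d); [|lra].
    apply Hlub. intros x Sx. pose proof (Hub x Sx) as Hxc. destruct Sx as [Hx Hux].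
    destruct (Rle_dec x (c - d)) as [Hxd|Hxd]; [exact Hxd|exfalso].
    specialize (HB x). rewrite Rabs_left1 in HB by lra.
    assert (Hne : x <> c) by (intros ->; lra).
    specialize (HB ltac:(lra) Hx). nra. }
  destruct (Rle_lt_or_eq_dec c b Hcb) as [Hlt|Heq]; [exfalso|subst c; exact Sc].
  (* If c < b, this point to the right of c still belongs to S, against the choice of c. *)
  set (y := Rmin b (c + d / 2)).
  assert (Hy : c < y <= b /\ y <= c + d / 2).
  { unfold y. split; [split|]; [apply Rmin_glb_lt; lra|apply Rmin_l|apply Rmin_r]. }
  specialize (HB y). rewrite Rabs_pos_eq in HB by lra.
  specialize (HB ltac:(lra) ltac:(lra)).
  assert (Sy : S y) by (split; [lra|nra]).
  pose proof (Hub y Sy). lra.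
Qed.

Lemma is_derive_locally_le (f : R -> R) (x l d : R) :
  is_derive f x l -> 0 < d ->
  locally x (fun y => Rabs (f y - f x - (y - x) * l) <= d * Rabs (y - x)).
Proof.
  intros [_ H] Hd. specialize (H x (fun P HP => HP) (mkposreal d Hd)).
  exact H.
Qed.

Lemma Cmod_le_Rabs (x y : R) : Cmod (x, y) <= Rabs x + Rabs y.
Proof.
  replace (x, y) with (RtoC x + Ci * RtoC y)%C
    by (apply injective_projections; simpl; ring).
  apply Rle_trans with (1 := Cmod_triangle _ _).
  rewrite Cmod_mult, !Cmod_R, Cmod_Ci. lra.
Qed.

Lemma Cmod_curve_increment (g : R -> C) (x p1 p2 d : R) :
  is_derive (fun s => Re (g s)) x p1 -> is_derive (fun s => Im (g s)) x p2 -> 0 < d ->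
  locally x (fun y => Rabs (Cmod (g y) - Cmod (g x)) <= (Cmod (p1, p2) + d) * Rabs (y - x)).
Proof.
  intros H1 H2 Hd. assert (Hd2 : 0 < d / 2) by lra.
  apply is_derive_locally_le with (2 := Hd2) in H1.
  apply is_derive_locally_le with (2 := Hd2) in H2.
  apply filter_imp with (2 := filter_and _ _ H1 H2). clear H1 H2.
  intros y [H1 H2].
  apply Rle_trans with (1 := Cmod_triangle_inv _ _).
  replace (g y - g x)%C with (RtoC (y - x) * (p1, p2) +
    (Re (g y) - Re (g x) - (y - x) * p1, Im (g y) - Im (g x) - (y - x) * p2)%R)%C
    by (apply injective_projections; unfold Re, Im; simpl; ring).
  apply Rle_trans with (1 := Cmod_triangle _ _).
  rewrite Cmod_mult, Cmod_R.
  pose proof (Cmod_le_Rabs (Re (g y) - Re (g x) - (y - x) * p1)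
    (Im (g y) - Im (g x) - (y - x) * p2)).
  lra.
Qed.

(* The radius of a curve need not be differentiable where the curve passes through 0,
   so the length is compared with the radial increment through local Lipschitz bounds. *)
Lemma radial_primitive_curve_increment (Rad : Rbar) (rho : C -> R) (g : R -> C)
    (x p1 p2 d : R) :
  conformal_metric (disk Rad) rho -> radial (disk Rad) rho -> disk Rad (g x) ->
  is_derive (fun s => Re (g s)) x p1 -> is_derive (fun s => Im (g s)) x p2 -> 0 < d ->
  locally x (fun y =>
    Rabs (radial_primitive rho (Cmod (g y)) - radial_primitive rho (Cmod (g x)))
      <= (rho (g x) * Cmod (p1, p2) + d) * Rabs (y - x)).
Proof.
  intros Hrho Hradial Hx H1 H2 Hd.
  pose proof (proj2 Hrho _ Hx) as Hr. pose proof (Cmod_ge_0 (p1, p2)) as Hp.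
  set (p := Cmod (p1, p2)) in *. set (r := rho (g x)) in *.
  (* As e <= 1, (r + e)(p + e) - r p = e (r + p + e) <= e (r + p + 1) <= d. *)
  set (e := Rmin 1 (d / (r + p + 1))).
  assert (He : 0 < e <= 1).
  { unfold e. split; [apply Rmin_glb_lt; [lra|apply Rdiv_lt_0_compat; lra]|apply Rmin_l]. }
  assert (Hed : (r + e) * (p + e) <= r * p + d).
  { assert (He2 : e * (r + p + 1) <= d).
    { apply Rle_trans with (d / (r + p + 1) * (r + p + 1)).
      - apply Rmult_le_compat_r; [lra|apply Rmin_r].
      - right. field. lra. }
    nra. }
  assert (Dc : disk Rad (RtoC (Cmod (g x)))).
  { apply disk_le with (1 := Hx). rewrite Cmod_R, Rabs_pos_eq; [lra|apply Cmod_ge_0]. }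
  pose proof (radial_primitive_derive Rad rho _ Hrho Dc) as HG.
  rewrite <- (Hradial _ Hx) in HG. fold r in HG.
  apply is_derive_locally_le with (2 := proj1 He) in HG.
  assert (Cg : continuous (fun s => Cmod (g s)) x).
  { apply (continuous_comp g Cmod); [|apply continuous_Cmod].
    apply continuous_ext with (fun s => (Re (g s), Im (g s)));
      [intros s; symmetry; apply surjective_pairing|].
    apply continuous_pair_C; apply (ex_derive_continuous (V := R_NormedModule));
      eexists; eassumption. }
  apply Cg in HG.
  pose proof (Cmod_curve_increment g x p1 p2 e H1 H2 (proj1 He)) as HC. fold p in HC.
  unfold filtermap in HG.
  apply filter_imp with (2 := filter_and _ _ HG HC). clear HG HC Cg.
  intros y [HG HC].
  set (D := Cmod (g y) - Cmod (g x)) in *.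
  set (K := radial_primitive rho (Cmod (g y)) - radial_primitive rho (Cmod (g x))) in *.
  assert (HK : Rabs K <= (r + e) * Rabs D).
  { replace K with ((K - D * r) + D * r) by ring.
    apply Rle_trans with (1 := Rabs_triang _ _).
    rewrite Rabs_mult, (Rabs_pos_eq r) by lra. lra. }
  apply Rle_trans with (1 := HK).
  apply Rle_trans with ((r + e) * ((p + e) * Rabs (y - x))).
  - apply Rmult_le_compat_l; lra.
  - rewrite <- Rmult_assoc. apply Rmult_le_compat_r; [apply Rabs_pos|exact Hed].
Qed.

Lemma C1_curve_continuous (g : R -> C) (s : R) :
  C1_line (fun s => Re (g s)) -> C1_line (fun s => Im (g s)) -> continuous g s.
Proof.
  intros H1 H2.
  apply continuous_ext with (fun s => (Re (g s), Im (g s)));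
    [intros t; symmetry; apply surjective_pairing|].
  apply continuous_pair_C; apply (ex_derive_continuous (V := R_NormedModule));
  [apply H1|apply H2].
Qed.

Lemma speed_density_continuous (Rad : Rbar) (rho : C -> R) (g : R -> C) (s : R) :
  conformal_metric (disk Rad) rho ->
  C1_line (fun s => Re (g s)) -> C1_line (fun s => Im (g s)) -> disk Rad (g s) ->
  continuous (fun t => rho (g t) * speed g t) s.
Proof.
  intros Hrho H1 H2 Hs. apply continuous_Rmult.
  - apply (continuous_comp g rho); [apply C1_curve_continuous; assumption|].
    apply C1_grad_continuous with (1 := metric_C1_grad Rad rho Hrho), Hs.
  - apply (continuous_comp
      (fun s => (Derive (fun s => Re (g s)) s, Derive (fun s => Im (g s)) s)) Cmod);
      [|apply continuous_Cmod].
    apply continuous_pair_C; [apply H1|apply H2].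
Qed.

Lemma radial_primitive_le_C1_length (Rad : Rbar) (rho : C -> R) (g : R -> C) (a b : R) :
  conformal_metric (disk Rad) rho -> radial (disk Rad) rho ->
  C1_line (fun s => Re (g s)) -> C1_line (fun s => Im (g s)) -> a <= b ->
  (forall s, a <= s <= b -> disk Rad (g s)) ->
  ex_RInt (fun t => rho (g t) * speed g t) a b /\
  radial_primitive rho (Cmod (g a)) - radial_primitive rho (Cmod (g b))
    <= RInt (fun t => rho (g t) * speed g t) a b.
Proof.
  intros Hrho Hradial H1 H2 Hab HD.
  set (v := fun t => rho (g t) * speed g t).
  assert (Cv : forall s, disk Rad (g s) -> continuous v s)
    by (intros; apply (speed_density_continuous Rad); assumption).
  assert (Ev : forall c, a <= c <= b -> ex_RInt v a c).
  { intros c Hc. apply (ex_RInt_continuous (V := R_CompleteNormedModule)).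
    rewrite Rmin_left, Rmax_right by lra. intros z Hz. apply Cv, HD; lra. }
  split; [apply Ev; lra|].
  set (N := fun s => radial_primitive rho (Cmod (g s))).
  change (N a - N b <= RInt v a b).
  apply le_epsilon. intros eps Heps.
  (* The error 2 d (b - a) must stay below eps; the added 1 covers a = b. *)
  set (d := eps / (2 * (b - a + 1))).
  assert (Hd : 0 < d) by (apply Rdiv_lt_0_compat; lra).
  assert (Hde : 2 * d * (b - a) <= eps).
  { unfold d. apply Rmult_le_reg_r with (b - a + 1); [lra|].
    replace (2 * (eps / (2 * (b - a + 1))) * (b - a) * (b - a + 1)) with (eps * (b - a))
      by (field; lra). nra. }
  (* Near x, N falls at a rate of at most v x + d while the integral grows at a rate of at least v x
     - d; the slope 2 d compensates both errors. *)
  assert (Hmono : N a + RInt v a a + 2 * d * a <= N b + RInt v a b + 2 * d * b).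
  { apply (locally_nondecreasing_le (fun s => N s + RInt v a s + 2 * d * s)); [exact Hab|].
    intros x Hx.
    pose proof (radial_primitive_curve_increment Rad rho g x _ _ d Hrho Hradial (HD x Hx)
      (Derive_correct _ _ (proj1 (H1 x))) (Derive_correct _ _ (proj1 (H2 x))) Hd) as L1.
    change (rho (g x) * Cmod (Derive (fun s => Re (g s)) x, Derive (fun s => Im (g s)) x))
      with (v x) in L1.
    assert (HV : is_derive (fun s => RInt v a s) x (v x)).
    { apply (is_derive_RInt (V := R_NormedModule) v _ a); [|apply Cv, HD, Hx].
      (* At an end point of [a, b] the two-sided derivative also needs the integrand just outside,
         where [g] lies in the disk by openness. *)
      destruct (C1_curve_continuous g x H1 H2 _ (disk_open _ _ (HD x Hx))) as [e He].
      exists e. intros y Hy. apply (RInt_correct (V := R_CompleteNormedModule)).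
      apply (ex_RInt_continuous (V := R_CompleteNormedModule)). intros z Hz. apply Cv.
      destruct (Rle_dec z x) as [Hzx|Hzx].
      - destruct (Rle_dec a z) as [Haz|Haz]; [apply HD; lra|].
        apply He. change (Rabs (z - x) < e). change (Rabs (y - x) < e) in Hy.
        apply Rle_lt_trans with (2 := Hy). unfold Rmin, Rmax in Hz. destruct (Rle_dec a y);
        unfold Rabs; do 2 destruct Rcase_abs; lra.
      - apply He. change (Rabs (z - x) < e). change (Rabs (y - x) < e) in Hy.
        apply Rle_lt_trans with (2 := Hy). unfold Rmin, Rmax in Hz. destruct (Rle_dec a y);
        unfold Rabs; do 2 destruct Rcase_abs; lra. }
    apply is_derive_locally_le with (2 := Hd) in HV.
    apply filter_imp with (2 := filter_and _ _ L1 HV). clear L1 HV.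
    intros y [L1 HV] _.
    change (radial_primitive rho (Cmod (g y)) - radial_primitive rho (Cmod (g x)))
      with (N y - N x) in L1.
    set (V := RInt v a y - RInt v a x) in *.
    apply Rabs_le_between in L1. apply Rabs_le_between in HV.
    replace (N y + RInt v a y + 2 * d * y - (N x + RInt v a x + 2 * d * x))
      with ((N y - N x) + V + 2 * d * (y - x)) by (unfold V; ring).
    destruct (Rle_dec x y) as [Hxy|Hxy].
    - rewrite (Rabs_pos_eq (y - x)) in * by lra.
      apply Rmult_le_pos; lra.
    - rewrite (Rabs_left (y - x)) in * by lra.
      assert ((N y - N x) + V + 2 * d * (y - x) <= 0) by lra. nra. }
  rewrite RInt_point in Hmono. unfold zero in Hmono; simpl in Hmono. lra.
Qed.

(** The bounds for the C^1 pieces telescope, by induction on the number of pieces already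
    covered. *)
Lemma radial_primitive_le_length (Rad : Rbar) (rho : C -> R) (w1 w2 : C) (gamma : R -> C) :
  conformal_metric (disk Rad) rho -> radial (disk Rad) rho ->
  curve_joining (disk Rad) w1 w2 gamma ->
  radial_primitive rho (Cmod w1) - radial_primitive rho (Cmod w2) <= rho_length rho gamma.
Proof.
  intros Hrho Hradial ((n & t & H0 & Hn & Hp) & HD & <- & <-).
  assert (Hinc : forall i j, (i <= j <= n)%nat -> t i <= t j).
  { intros i j [Hij Hjn]. induction Hij as [|j Hij IH]; [lra|].
    destruct (Hp j Hjn) as [Hlt _]. specialize (IH ltac:(lia)). lra. }
  set (v := fun s => rho (gamma s) * speed gamma s).
  assert (HI : forall k, (k <= n)%nat -> ex_RInt v 0 (t k) /\
    radial_primitive rho (Cmod (gamma 0)) - radial_primitive rho (Cmod (gamma (t k)))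
      <= RInt v 0 (t k)).
  { induction k as [|k IH]; intros Hk.
    - rewrite H0. split; [apply ex_RInt_point|]. rewrite RInt_point. unfold zero; simpl. lra.
    - destruct (IH ltac:(lia)) as [E1 L1].
      destruct (Hp k Hk) as (Hlt & g & G1 & G2 & Hg).
      assert (Hk0 : 0 <= t k) by (rewrite <- H0; apply Hinc; lia).
      assert (Hk1 : t (S k) <= 1) by (rewrite <- Hn; apply Hinc; lia).
      destruct (radial_primitive_le_C1_length Rad rho g (t k) (t (S k)) Hrho Hradial G1 G2)
        as [E2 L2]; [lra|intros s Hs; rewrite <- Hg by exact Hs; apply HD; lra|].
      assert (Hext : forall s, Rmin (t k) (t (S k)) < s < Rmax (t k) (t (S k)) ->
        rho (g s) * speed g s = v s).
      { rewrite Rmin_left, Rmax_right by lra. intros s Hs. unfold v.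
        rewrite Hg by lra. f_equal. unfold speed.
        (* Derivatives of gamma and of its C^1 extension agree only inside the open piece, which
           suffices for the integral. *)
        assert (Hloc : locally s (fun y => g y = gamma y)).
        { apply filter_imp with (fun y => t k < y < t (S k)).
          - intros y Hy. symmetry. apply Hg. lra.
          - apply (open_and (T := R_UniformSpace) (fun y => t k < y) (fun y => y < t (S k)));
              [apply open_gt|apply open_lt|exact Hs]. }
        f_equal. f_equal; apply Derive_ext_loc; apply filter_imp with (2 := Hloc);
          intros y ->; reflexivity. }
      apply (ex_RInt_ext _ _ _ _ Hext) in E2.
      rewrite (RInt_ext _ _ _ _ Hext) in L2.
      split; [apply ex_RInt_Chasles with (t k); assumption|].
      pose proof (RInt_Chasles v 0 (t k) (t (S k)) E1 E2) as HC.
      unfold plus in HC; simpl in HC. rewrite <- HC.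
      rewrite <- !Hg in L2 by lra. lra. }
  destruct (HI n (le_n n)) as [_ HL]. rewrite Hn in HL. exact HL.
Qed.

Lemma geodesic_disk_bound (Rad : Rbar) (rho : C -> R) (r x : R) :
  conformal_metric (disk Rad) rho -> radial (disk Rad) rho ->
  geodesic_disk (disk Rad) rho (RtoC 0) r (RtoC x) ->
  Rabs (radial_primitive rho x) < r.
Proof.
  intros Hrho Hradial [Dx Hd].
  rewrite <- (radial_primitive_abs Rad rho x Hrho Hradial Dx).
  (* If the bound failed, r would be a lower bound of the lengths of all curves to 0, hence of their
     infimum. *)
  apply Rnot_le_lt. intros Hle.
  apply (Rbar_lt_not_le _ _ Hd). unfold d_rho.
  apply (proj2 (Glb_Rbar_correct _)). intros l (gamma & Hg & ->). simpl.
  apply Rle_trans with (1 := Hle).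
  apply (radial_primitive_le_length Rad rho _ _ _ Hrho Hradial) in Hg.
  rewrite Cmod_R, Cmod_0 in Hg.
  replace (radial_primitive rho 0) with 0 in Hg
    by (unfold radial_primitive; rewrite RInt_point; reflexivity).
  lra.
Qed.

(** The straight segment runs monotonically along the real axis, so its length is the increment of
    the primitive up to sign. *)
Lemma d_rho_axis_le (Rad : Rbar) (rho : C -> R) (x y : R) :
  conformal_metric (disk Rad) rho -> disk Rad (RtoC x) -> disk Rad (RtoC y) ->
  Rbar_le (d_rho (disk Rad) rho (RtoC x) (RtoC y))
    (Rabs (radial_primitive rho y - radial_primitive rho x)).
Proof.
  intros Hrho Hx Hy.
  apply (proj1 (Glb_Rbar_correct _)).
  set (h := fun t => x + t * (y - x)).
  assert (Hh : forall t, is_derive h t (y - x)).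
  { intros t. unfold h. auto_derive; trivial. ring. }
  assert (Hh' : forall t, Derive h t = y - x) by (intros; apply is_derive_unique, Hh).
  assert (HD : forall t, 0 <= t <= 1 -> disk Rad (RtoC (h t))).
  { intros t Ht. unfold h. unfold disk in Hx, Hy. rewrite Cmod_R in Hx, Hy.
    assert (Hmax : disk Rad (RtoC (Rmax (Rabs x) (Rabs y)))).
    { unfold disk. rewrite Cmod_R, (Rabs_pos_eq (Rmax _ _)).
      - unfold Rmax. destruct (Rle_dec _ _); assumption.
      - apply Rle_trans with (1 := Rabs_pos x), Rmax_l. }
    apply disk_le with (1 := Hmax). rewrite !Cmod_R.
    pose proof (Rmax_l (Rabs x) (Rabs y)). pose proof (Rmax_r (Rabs x) (Rabs y)).
    pose proof (Rle_abs x). pose proof (Rle_abs y).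
    pose proof (Rle_abs (- x)) as Hx'. pose proof (Rle_abs (- y)) as Hy'.
    rewrite Rabs_Ropp in Hx', Hy'.
    apply Rle_trans with (2 := Rle_abs _). apply Rabs_le. split; nra. }
  exists (fun t => RtoC (h t)). split; [split; [|split; [|split]]|].
  (* One piece, with subdivision points INR 0 = 0 and INR 1 = 1. *)
  - exists 1%nat, INR. split; [reflexivity|split; [reflexivity|]].
    intros i Hi. rewrite S_INR. split; [lra|].
    exists (fun t => RtoC (h t)). split; [|split; [|reflexivity]].
    + intros t. split; [eexists; apply Hh|].
      apply continuous_ext with (fun _ => y - x);
        [intros s; symmetry; apply Hh'|apply continuous_const].
    + intros t. split; [apply (ex_derive_const (V := R_NormedModule) 0)|].
      apply continuous_ext with (fun _ => 0);
        [intros s; symmetry; apply (Derive_const 0)|apply continuous_const].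
  - exact HD.
  - unfold h. f_equal. ring.
  - unfold h. f_equal. ring.
  - unfold rho_length. symmetry. apply is_RInt_unique.
    assert (HI : is_RInt (fun t => (y - x) * rho (RtoC (h t))) 0 1
       (radial_primitive rho y - radial_primitive rho x)).
    { replace (radial_primitive rho y - radial_primitive rho x)
        with (minus (radial_primitive rho (h 1)) (radial_primitive rho (h 0))).
      2:{ unfold minus, plus, opp; simpl. unfold h.
          replace (x + 1 * (y - x)) with y by ring. replace (x + 0 * (y - x)) with x by ring.
          reflexivity. }
      apply (is_RInt_derive (fun t => radial_primitive rho (h t))).
      - rewrite Rmin_left, Rmax_right by lra. intros t Ht.
        apply (is_derive_comp (radial_primitive rho) h); [|apply Hh].
        apply (radial_primitive_derive Rad); auto.
      - rewrite Rmin_left, Rmax_right by lra. intros t Ht.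
        apply continuous_Rmult; [apply continuous_const|].
        apply (continuous_comp h (fun s => rho (RtoC s))).
        + apply (ex_derive_continuous (V := R_NormedModule)). eexists; apply Hh.
        + apply (metric_axis_continuous Rad); auto. }
    assert (Hsp : forall t, speed (fun t => RtoC (h t)) t = Rabs (y - x)).
    { intros t. unfold speed.
      change (Derive (fun s => Re (RtoC (h s))) t) with (Derive h t).
      change (Derive (fun s => Im (RtoC (h s))) t) with (Derive (fun _ => 0) t).
      rewrite Hh', Derive_const. apply Cmod_R. }
    destruct (Rle_dec x y) as [Hxy|Hxy].
    + rewrite Rabs_pos_eq.
      * apply is_RInt_ext with (2 := HI). intros t _. rewrite Hsp, Rabs_pos_eq by lra. simpl.
        apply Rmult_comm.
      * apply (is_RInt_ge_0 (fun t => (y - x) * rho (RtoC (h t))) 0 1); [lra|exact HI|].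
        intros t Ht. apply Rmult_le_pos; [lra|]. left. apply Hrho, HD. lra.
    + apply (is_RInt_opp (V := R_NormedModule)) in HI.
      rewrite <- Rabs_Ropp, Rabs_pos_eq.
      * apply is_RInt_ext with (2 := HI). intros t _. rewrite Hsp, Rabs_left by lra.
        unfold opp; simpl. ring.
      * apply (is_RInt_ge_0 (fun t => opp ((y - x) * rho (RtoC (h t)))) 0 1); [lra|exact HI|].
        intros t Ht. unfold opp; simpl.
        replace (- ((y - x) * rho (RtoC (h t)))) with ((x - y) * rho (RtoC (h t))) by ring.
        apply Rmult_le_pos; [lra|]. left. apply Hrho, HD. lra.
Qed.

(** * Two-sided bounds and the three inequalities *)

Lemma harm_Rabs_le_atan (E : C -> R) (q : C -> C) (z : C) :
  harm E q -> unit_bounded E -> E (RtoC 0) = 0 -> unit_disk z ->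
  Rabs (E z) <= 4 / PI * atan (Cmod z).
Proof.
  intros HE HB H0 Hz. apply Rabs_le. split.
  - assert (HB' : unit_bounded (fun z => - E z)) by (intros w Hw; pose proof (HB w Hw); lra).
    pose proof (harm_le_atan _ _ z (harm_opp E q HE) HB') as H. simpl in H.
    rewrite H0, Ropp_0 in H. specialize (H eq_refl Hz). lra.
  - apply (harm_le_atan E q z HE HB H0 Hz).
Qed.

(** Composition with [mobius z1] moves the base point z1 to 0. The preimage w of z2 has modulus
    equal to the argument of artanh in [d_hyp]. *)
Lemma harm_le_d_hyp (E : C -> R) (q : C -> C) (z1 z2 : C) :
  harm E q -> unit_bounded E -> unit_disk z1 -> unit_disk z2 ->
  E z2 - E z1 <= 4 / PI * d_hyp z1 z2.
Proof.
  intros HE HB H1 H2.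
  assert (Ho : forall w, unit_disk w -> unit_disk (- w)%C)
    by (intros w Hw; unfold unit_disk, disk in *; rewrite Cmod_opp; exact Hw).
  destruct (mobius_holo z1 H1) as (dp & ddp & Hp & Hdp & _).
  pose proof (harm_comp _ _ _ _ _ HE Hp Hdp (fun z => mobius_unit_disk z1 z H1)) as HE'.
  set (w := mobius (- z1) z2).
  assert (Hw : unit_disk w) by (apply mobius_unit_disk; [apply Ho|]; assumption).
  pose proof (mobius_den z1 w H1 Hw) as Hd1.
  pose proof (mobius_den (- z1)%C z2 (Ho _ H1) H2) as Hd2.
  pose proof (mobius_den (- z1)%C z1 (Ho _ H1) H1) as Hd3.
  assert (Hc : Cconj (- z1)%C = (- Cconj z1)%C)
    by (apply injective_projections; simpl; ring).
  rewrite Hc in Hd2, Hd3.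
  assert (HB' : unit_bounded (fun z => E (mobius z1 z)))
    by (intros z Hz; apply HB, mobius_unit_disk; assumption).
  pose proof (harm_sub_le_artanh _ _ w HE' HB' Hw) as H. simpl in H.
  replace (mobius z1 (RtoC 0)) with z1 in H.
  2:{ unfold mobius. field. }
  replace (mobius z1 w) with z2 in H.
  (* Clearing the denominator of w turns 1 + conj z1 w into 1 - conj z1 z1, nonzero by [Hd3]. *)
  2:{ unfold w, mobius in *. rewrite Hc in *. field. split; [exact Hd2|].
      replace (RtoC 1 + - Cconj z1 * z2 + Cconj z1 * (z2 + - z1))%C
        with (RtoC 1 + - Cconj z1 * z1)%C by ring. exact Hd3. }
  apply Rle_trans with (1 := H). right. unfold d_hyp. do 2 f_equal.
  rewrite <- Cmod_opp. f_equal. unfold w, mobius. rewrite Hc. field.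
  intros K. apply Hd2. rewrite <- K. ring.
Qed.

Theorem corollary1p3 (Rad : Rbar) (rho : C -> R) (r : R) (total : Rbar)
    (f : C -> R)
    (HRad : Rbar_lt (Finite 0) Rad)
    (Hrho : conformal_metric (disk Rad) rho)
    (Hradial : radial (disk Rad) rho)
    (Hr : 0 < r)
    (Htotal : is_integral_upto (fun s => rho (RtoC s)) Rad total)
    (Hrtotal : Rbar_lt (Finite r) total)
    (Hf : rho_harmonic (disk Rad) rho (fun z => RtoC (f z)))
    (Hfr : forall z : C, unit_disk z ->
       geodesic_disk (disk Rad) rho (RtoC 0) r (RtoC (f z)))
    (Hf0 : f (RtoC 0) = 0) :
  forall z z1 z2 : C, unit_disk z -> unit_disk z1 -> unit_disk z2 ->
    RInt (fun s => rho (RtoC s)) 0 (Rabs (f z))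
      <= 4 * r / PI * atan (Cmod z) /\
    rho (RtoC (Rabs (f z))) * norm_grad f z
      <= 4 * r / PI * (1 / (1 - Cmod z ^ 2)) /\
    Rbar_le (d_rho (disk Rad) rho (RtoC (f z1)) (RtoC (f z2)))
      (Finite (4 * r / PI * d_hyp z1 z2)).
Proof.
  intros z z1 z2 Hz Hz1 Hz2.
  pose proof PI_RGT_0 as Hpi.
  (* The scaling by 1/r turns |G o f| < r into the range (-1, 1). *)
  pose proof (rho_harmonic_harm Rad rho f (/ r) Hrho Hf) as HE.
  set (E := fun z => / r * radial_primitive rho (f z)) in *.
  assert (HrE : forall w, radial_primitive rho (f w) = r * E w)
    by (intros w; unfold E; field; lra).
  assert (HB : unit_bounded E).
  { intros w Hw. pose proof (geodesic_disk_bound Rad rho r _ Hrho Hradial (Hfr w Hw)) as H.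
    rewrite HrE, Rabs_mult, (Rabs_pos_eq r) in H by lra.
    apply Rabs_lt_between. apply Rmult_lt_reg_l with r; lra. }
  assert (HD : forall w, unit_disk w -> disk Rad (RtoC (f w))) by apply Hf.
  split; [|split].
  - change (radial_primitive rho (Rabs (f z)) <= 4 * r / PI * atan (Cmod z)).
    rewrite (radial_primitive_abs Rad rho _ Hrho Hradial (HD z Hz)).
    rewrite HrE, Rabs_mult, (Rabs_pos_eq r) by lra.
    assert (HE0 : E (RtoC 0) = 0).
    { unfold E, radial_primitive. rewrite Hf0, RInt_point. apply Rmult_0_r. }
    pose proof (harm_Rabs_le_atan _ _ z HE HB HE0 Hz) as H.
    apply Rmult_le_compat_l with (r := r) in H; [|lra].
    apply Rle_trans with (1 := H). right. field. lra.
  - rewrite (metric_axis_even Rad rho _ Hradial (HD z Hz)).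
    pose proof (harm_grad_le _ _ z HE HB Hz) as H.
    pose proof (proj2 Hrho _ (HD z Hz)) as Hp.
    assert (Hq : Cmod (/ r * rho (RtoC (f z)) * pdx f z, - (/ r * rho (RtoC (f z)) * pdy f z))
      = / r * (rho (RtoC (f z)) * norm_grad f z)).
    { assert (Hk : 0 <= / r * rho (RtoC (f z)))
        by (apply Rmult_le_pos; [left; apply Rinv_0_lt_compat|]; lra).
      transitivity (sqrt (Rsqr (/ r * rho (RtoC (f z)))) * norm_grad f z);
        [|rewrite sqrt_Rsqr by exact Hk; ring].
      unfold norm_grad. rewrite <- sqrt_mult_alt by apply Rle_0_sqr.
      unfold Cmod, Rsqr; simpl. f_equal. ring. }
    cbv beta in H. rewrite Hq in H.
    assert (Hm : 0 < 1 - Cmod z ^ 2).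
    { unfold unit_disk, disk in Hz; simpl in Hz. pose proof (Cmod_ge_0 z). nra. }
    assert (Hcos : 4 / PI * cos (PI / 2 * E z) <= 4 / PI).
    { rewrite <- (Rmult_1_r (4 / PI)) at 2. apply Rmult_le_compat_l.
      - apply Rdiv_le_0_compat; lra.
      - apply COS_bound. }
    (* Undoes the scaling and returns to the form of [harm_grad_le], with the cosine bounded by
       1. *)
    apply Rmult_le_reg_r with (/ r * (1 - Cmod z ^ 2)).
    { apply Rmult_lt_0_compat; [apply Rinv_0_lt_compat|]; lra. }
    apply Rle_trans with (4 / PI); [lra|]. right. field. repeat split; lra.
  - apply Rbar_le_trans with (1 := d_rho_axis_le Rad rho _ _ Hrho (HD z1 Hz1) (HD z2 Hz2)).
    simpl. rewrite !HrE.
    pose proof (harm_le_d_hyp _ _ z1 z2 HE HB Hz1 Hz2) as H1.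
    (* The opposite inequality comes from -E at the same pair of points. *)
    assert (HB' : unit_bounded (fun z => - E z)) by (intros w Hw; pose proof (HB w Hw); lra).
    pose proof (harm_le_d_hyp _ _ z1 z2 (harm_opp _ _ HE) HB' Hz1 Hz2) as H2. simpl in H2.
    replace (4 * r / PI * d_hyp z1 z2) with (r * (4 / PI * d_hyp z1 z2)) by (field; lra).
    replace (r * E z2 - r * E z1) with (r * (E z2 - E z1)) by ring.
    rewrite Rabs_mult, (Rabs_pos_eq r) by lra.
    apply Rmult_le_compat_l; [lra|]. apply Rabs_le. lra.
Qed.
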